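(* Let $G$ be a countable, infinite group. Then the following are equivalent: (i) There is a comeager conjugacy class in $\Xi_{\mathrm{min}}(G)$. (ii) For every finite alphabet $A$, the set of minimal subshifts which are projectively isolated in $\mathcal{S}_{\mathrm{min}}(A^G)$ is dense in $\mathcal{S}_{\mathrm{min}}(A^G)$.
   Context: $\Omega$ denotes the Cantor space. $\mathrm{Homeo}(\Omega)$ carries the uniform convergence topology (equivalently, viewing homeomorphisms as automorphisms of the countable Boolean algebra of clopen subsets of $\Omega$, the topology of pointwise convergence on this discrete algebra), which makes it a Polish group. For a countable group $G$, $\Xi(G)=\mathrm{Hom}(G,\mathrm{Homeo}(\Omega))$ is the Polish space of actions of $G$ on $\Omega$ by homeomorphisms, a closed subspace of $\mathrm{Homeo}(\Omega)^G$. $\mathrm{Homeo}(\Omega)$ acts on $\Xi(G)$ by conjugation, $(f\cdot\xi)(g)=f\xi(g)f^{-1}$; orbits are called conjugacy classes. An action on a non-empty compact Hausdorff space is minimal if it has no proper non-empty closed invariant subset. $\Xi_{\mathrm{min}}(G)\subseteq\Xi(G)$ is the set of minimal actions, with the subspace topology; it is a conjugation-invariant $G_\delta$ set, hence Polish. For a finite (non-empty) alphabet $A$, $G$ acts on $A^G$ by $(g\cdot x)(h)=x(g^{-1}h)$. A subshift is a non-empty, closed, $G$-invariant subset of $A^G$. $\mathcal{S}(A^G)$ is the space of all subshifts of $A^G$ with the Vietoris topology, and $\mathcal{S}_{\mathrm{min}}(A^G)$ is the subspace of minimal subshifts. A factor map is a continuous, $G$-equivariant surjection. A subshift $X\in\mathcal{S}_{\mathrm{min}}(A^G)$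 is projectively isolated in $\mathcal{S}_{\mathrm{min}}(A^G)$ if there exist a finite alphabet $B$, a factor map $\Phi\colon B^G\to A^G$, and a non-empty open subset $\mathcal{U}\subseteq\mathcal{S}_{\mathrm{min}}(B^G)$ such that $\Phi[Y]=X$ for every $Y\in\mathcal{U}$ (where $\Phi[Y]$ is the image of $Y$). *)

(* Defs.v *)
From HB Require Import structures.
From mathcomp Require Import all_boot.
From mathcomp Require Import all_classical all_reals topology cantor.

Set Warnings "-redundant-canonical-projection".

Set Implicit Arguments.
Unset Strict Implicit.
Unset Printing Implicit Defensive.

Local Open Scope classical_set_scope.
Local Open Scope group_scope.

Section Category.
Context {T : topologicalType}.
Implicit Types S : set T.

Definition nowhere_dense S := (closure S)° = set0.

Definition meager S := exists F : nat -> set T,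
  (forall n, nowhere_dense (F n)) /\ S `<=` \bigcup_n F n.

Definition comeager S := meager (~` S).

End Category.

Section HomeoDef.
Context (T : uniformType).

Definition is_homeo (f : T -> T) := exists g : T -> T,
  [/\ cancel f g, cancel g f, continuous f & continuous g].

(* The subtype of a set carries the subspace topology, here the one induced
   by uniform convergence. *)
Definition Homeo : Type := set_type [set f : {uniform T -> T} | is_homeo f].

HB.instance Definition _ := Topological.on Homeo.

Definition homeo_fun (h : Homeo) : T -> T := val h.

Lemma homeo_funP (h : Homeo) : is_homeo (homeo_fun h).
Proof. by case: h => f fP; exact: set_mem fP. Qed.

Definition mk_homeo (f : T -> T) (fP : is_homeo f) : Homeo :=
  exist _ (f : {uniform T -> T}) (mem_set fP).

Lemma homeo_eqP (h k : Homeo) : homeo_fun h =1 homeo_fun k -> h = k.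
Proof. by move=> hk; apply/val_inj/funext. Qed.

Lemma is_homeo_id : is_homeo idfun.
Proof. by exists idfun; split=> // x; exact: cvg_id. Qed.

Lemma is_homeo_comp (f k : T -> T) :
  is_homeo f -> is_homeo k -> is_homeo (f \o k).
Proof.
move=> [f' [fK f'K fc f'c]] [k' [kK k'K kc k'c]]; exists (k' \o f'); split.
- exact: can_comp.
- exact: can_comp.
- by move=> x; apply: continuous_comp; [exact: kc|exact: fc].
- by move=> x; apply: continuous_comp; [exact: f'c|exact: k'c].
Qed.

Definition homeo_inv_fun (h : Homeo) : T -> T := projT1 (cid (homeo_funP h)).

Lemma homeo_funK (h : Homeo) : cancel (homeo_fun h) (homeo_inv_fun h).
Proof. by rewrite /homeo_inv_fun; case: cid => g []. Qed.

Lemma homeo_inv_funK (h : Homeo) : cancel (homeo_inv_fun h) (homeo_fun h).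
Proof. by rewrite /homeo_inv_fun; case: cid => g []. Qed.

Lemma is_homeo_inv (h : Homeo) : is_homeo (homeo_inv_fun h).
Proof.
by rewrite /homeo_inv_fun; case: cid => g [? ? ? ?]; exists (homeo_fun h).
Qed.

Definition homeo_one : Homeo := mk_homeo is_homeo_id.
Definition homeo_mul (h k : Homeo) : Homeo :=
  mk_homeo (is_homeo_comp (homeo_funP h) (homeo_funP k)).
Definition homeo_inv (h : Homeo) : Homeo := mk_homeo (is_homeo_inv h).

Lemma homeo_mulA : associative homeo_mul.
Proof. by move=> f g h; exact: homeo_eqP. Qed.
Lemma homeo_mul1 : left_id homeo_one homeo_mul.
Proof. by move=> f; exact: homeo_eqP. Qed.
Lemma homeo_mulr1 : right_id homeo_one homeo_mul.
Proof. by move=> f; exact: homeo_eqP. Qed.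
Lemma homeo_mulV : left_inverse homeo_one homeo_inv homeo_mul.
Proof. by move=> f; apply: homeo_eqP => x; exact: homeo_funK. Qed.
Lemma homeo_mulrV : right_inverse homeo_one homeo_inv homeo_mul.
Proof. by move=> f; apply: homeo_eqP => x; exact: homeo_inv_funK. Qed.

HB.instance Definition _ := isGroup.Build Homeo
  homeo_mulA homeo_mul1 homeo_mulr1 homeo_mulV homeo_mulrV.

End HomeoDef.

Section Minimality.
Context {G : Type} {T : topologicalType} (act : G -> T -> T).

Definition invariant_set (X : set T) := forall g x, X x -> X (act g x).

(* Minimality of the action restricted to the closed invariant set X, whose
   closed subsets are the closed subsets of T included in X. *)
Definition minimal_on (X : set T) := forall Y : set T,
  Y `<=` X -> closed Y -> Y !=set0 -> invariant_set Y -> Y = X.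

End Minimality.

Section Actions.
Context (G : groupType).

Definition Xi : Type := set_type
  [set xi : {ptws G -> Homeo cantor_space} | monoid_morphism xi].

HB.instance Definition _ := Topological.on Xi.

Definition Xi_fun (xi : Xi) : G -> Homeo cantor_space := val xi.

Lemma Xi_funP (xi : Xi) : monoid_morphism (Xi_fun xi).
Proof. by case: xi => f fP; exact: set_mem fP. Qed.

Lemma conj_morphism (f : Homeo cantor_space) (xi : Xi) :
  monoid_morphism (fun g => f * Xi_fun xi g * f^-1).
Proof.
have [xi1 xiM] := Xi_funP xi; split=> [|g h].
  by rewrite xi1 mulg1 mulgV.
by rewrite xiM !mulgA mulgVK.
Qed.

Definition Xi_conj (f : Homeo cantor_space) (xi : Xi) : Xi :=
  exist _ ((fun g => f * Xi_fun xi g * f^-1) : {ptws G -> Homeo cantor_space})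
    (mem_set (conj_morphism f xi)).

Definition conjugacy_class (xi : Xi) : set Xi := range (Xi_conj ^~ xi).

Definition minimal_action (xi : Xi) :=
  minimal_on (fun g => homeo_fun (Xi_fun xi g)) [set: cantor_space].

Definition Xi_min : Type := set_type [set xi : Xi | minimal_action xi].

HB.instance Definition _ := Topological.on Xi_min.

Definition Xi_min_val (xi : Xi_min) : Xi := val xi.

Definition conjugacy_class_min (xi : Xi_min) : set Xi_min :=
  Xi_min_val @^-1` conjugacy_class (Xi_min_val xi).

End Actions.

(* The Vietoris topology is put on all subsets of T, so that spaces of closed
   sets can be taken as topological subspaces. *)
Definition vietoris (T : Type) : Type := set T.

HB.instance Definition _ (T : Type) := Choice.copy (vietoris T) (set T).

Definition vietoris_subbase (T : Type) (i : bool * set T) : set (vietoris T) :=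
  if i.1 then [set X : set T | X `<=` i.2]
  else [set X : set T | X `&` i.2 !=set0].

HB.instance Definition _ (T : topologicalType) :=
  isSubBaseTopological.Build (vietoris T)
    [set i : bool * set T | open i.2] (@vietoris_subbase T).

Section Subshifts.
Context (G : groupType).

Definition full_shift (A : finType) : Type :=
  {ptws G -> discrete_topology A}.

HB.instance Definition _ (A : finType) := Topological.on (full_shift A).

Definition shift (A : finType) (g : G) (x : full_shift A) : full_shift A :=
  fun h => x (g^-1 * h).

Definition is_subshift (A : finType) (X : set (full_shift A)) :=
  [/\ X !=set0, closed X & invariant_set (@shift A) X].

Definition subshifts (A : finType) : Type :=
  set_type [set X : vietoris (full_shift A) | is_subshift X].

HB.instance Definition _ (A : finType) := Topological.on (subshifts A).

Definition subshift_set (A : finType) (X : subshifts A) :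
  set (full_shift A) := val X.

Definition minimal_subshifts (A : finType) : Type :=
  set_type [set X : subshifts A | minimal_on (@shift A) (subshift_set X)].

HB.instance Definition _ (A : finType) := Topological.on (minimal_subshifts A).

Definition minimal_subshift_set (A : finType) (X : minimal_subshifts A) :
  set (full_shift A) := subshift_set (val X).

Definition factor_map (B A : finType) (Phi : full_shift B -> full_shift A) :=
  [/\ continuous Phi,
      forall g x, Phi (shift g x) = shift g (Phi x) &
      forall y, exists x, Phi x = y].

Definition projectively_isolated (A : finType) (X : minimal_subshifts A) :=
  exists (B : finType) (Phi : full_shift B -> full_shift A)
    (U : set (minimal_subshifts B)),
    [/\ (0 < #|B|)%N, factor_map Phi, open U, U !=set0 &
        forall Y, U Y ->
          Phi @` minimal_subshift_set Y = minimal_subshift_set X].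

End Subshifts.

(* Main.v *)
Require Import Defs.
From mathcomp Require Import finmap.
From mathcomp Require Import all_boot.
From mathcomp Require Import all_classical all_reals topology.
From mathcomp Require Import cantor.

(** Write Omega for the Cantor space.  A continuous map [a] from Omega to a
    finite alphabet, that is a labelled clopen partition, codes an action [xi]
    into a subshift [symbolic_factor a xi].  Actions are close when finitely
    many group elements agree to finite precision, minimal subshifts are close
    when they have the same patterns on a large finite window, and coding is
    continuous.  Conversely, [realize] says that every minimal subshift is a
    symbolic factor of a minimal action, and [realize_close] that a minimal
    subshift with the same patterns as [symbolic_factor a xi] is the factor
    coded by the same [a] for an action close to [xi]: two nonempty perfect
    compact sets are homeomorphic through a map respecting given clopen
    partitions, so a minimal system over the subshift can be laid on Omega
    along the partition generated by [xi].  The system has to be perfect; a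
    minimal system on which the infinite group acts freely is, and one is found
    over any minimal subshift by adjoining 3-colorings of the group.

    Both conditions of the theorem are equivalent to [densely_stable]: near
    every action there is one at which a given symbolic factor is locally
    constant.

    A comeager class gives stability.  For fixed [a], conjugating [xi0] by [f]
    amounts to replacing [a] by [a \o f], and there are countably many clopen
    partitions, so that countably many subshifts occur as factors over the
    class.  By the Baire property one of the closed sets on which the factor is
    constant has interior near any given action.

    Stability gives projective isolation.  If the factor coded by [b] is
    constant near [eta], let [c] refine [b] enough for the patterns of the
    factor coded by [c] to describe that neighbourhood.  By [realize_close] all
    minimal subshifts with these patterns are factors coded by [c] of actions in
    it, so they project onto the same subshift.  Conversely, for a projectively
    isolated [Y] witnessed by [Phi] and [U], realizing a member of [U] so that
    its image by [Phi] is read off from a given partition yields an action near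
    which the factor coded by that partition stays equal to [Y].

    Stability gives a comeager class.  Call an action generic when its factors
    are locally constant near it and when, for every minimal extension [X] of a
    symbolic factor, its partition refines to one whose factor has the same
    patterns as [X] on a prescribed window.  Genericity amounts to countably
    many conditions, each containing a dense open set, because two minimal
    extensions of one minimal subshift have a common minimal extension inside
    their fibered product ([amalgamate]).  Two generic actions
    are conjugate by back and forth on pairs of partitions with equal factors:
    a finer partition on one side has a locally constant factor, hence one
    determined by finitely many patterns of a still finer partition, and those
    patterns are matched on the other side. *)

Set Implicit Arguments.
Unset Strict Implicit.
Unset Printing Implicit Defensive.

Local Open Scope classical_set_scope.
Local Open Scope group_scope.

(** * Words along an enumerated index set *)

Lemma fin_bound (T : finType) (Q : T -> nat -> Prop) :
  (forall t, exists n, Q t n) ->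
  (forall t n m, n <= m -> Q t n -> Q t m) ->
  exists n, forall t, Q t n.
Proof.
move=> /choice[N NQ] Qmono; exists (\max_t N t) => t.
by apply: Qmono (NQ t); exact: leq_bigmax.
Qed.

Lemma bij_surj (T : Type) (e : nat -> T) :
  bijective e -> forall t, exists n, e n = t.
Proof. by move=> [idx _ idxK] t; exists (idx t). Qed.

Section Words.
Variables (I : Type) (e : nat -> I) (D : Type).
Implicit Types (x y z : I -> D) (X : set (I -> D)).

(** The ultrametric of words along the enumeration [e] of their indices: all
    the topology below is expressed through [agree]. *)
Definition agree n x y := forall k, k < n -> x (e k) = y (e k).

Lemma agree_refl n x : agree n x x.
Proof. by []. Qed.

Lemma agree_sym n x y : agree n x y -> agree n y x.
Proof. by move=> xy k /xy. Qed.

Lemma agree_trans n y x z : agree n x y -> agree n y z -> agree n x z.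
Proof. by move=> xy yz k kn; rewrite xy // yz. Qed.

Lemma agree_le n m x y : m <= n -> agree n x y -> agree m x y.
Proof. by move=> mn xy k km; apply: xy; exact: leq_trans km mn. Qed.

Definition limit_closed X :=
  forall x, (forall n, exists2 y, X y & agree n x y) -> X x.

Definition finitary (S : Type) (f : (I -> D) -> S) :=
  exists n, forall x y, agree n x y -> f x = f y.

Definition prefix n x : n.-tuple D := [tuple x (e k) | k < n].

Lemma prefixP n x y : prefix n x = prefix n y <-> agree n x y.
Proof.
split=> [xy k kn|xy].
  by have := congr1 (fun t => tnth t (Ordinal kn)) xy; rewrite !tnth_mktuple.
by apply/eq_from_tnth => k; rewrite !tnth_mktuple; exact: xy.
Qed.

Lemma finitary_prefix n : finitary (prefix n).
Proof. by exists n => x y /prefixP. Qed.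

Lemma finitary_comp (S U : Type) (r : S -> U) f :
  finitary f -> finitary (r \o f).
Proof. by move=> [n fn]; exists n => x y /fn /= ->. Qed.

Lemma finitary_pair (S U : Type) (f : (I -> D) -> S) (g : (I -> D) -> U) :
  finitary f -> finitary g -> finitary (fun x => (f x, g x)).
Proof.
move=> [n fn] [m gm]; exists (maxn n m) => x y xy; congr (_, _).
  by apply/fn/(agree_le _ xy); exact: leq_maxl.
by apply/gm/(agree_le _ xy); exact: leq_maxr.
Qed.

Lemma finitary_prefix_factor (S : Type) (f : (I -> D) -> S) n :
  (forall x y, agree n x y -> f x = f y) -> (I -> D) ->
  exists r : n.-tuple D -> S, forall x, f x = r (prefix n x).
Proof.
move=> fn x0.
exists (fun t => if pselect (exists x, prefix n x = t) is left xP
  then f (projT1 (cid xP)) else f x0) => x.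
case: pselect => [xP|[]]; last by exists x.
by apply: fn; apply/prefixP; rewrite (projT2 (cid xP)).
Qed.

Hypothesis e_surj : forall i, exists n, e n = i.

Lemma finitary_coord i : finitary (fun x => x i).
Proof. by have [n <-] := e_surj i; exists n.+1 => x y; apply. Qed.

Lemma agree_ext x y : (forall n, agree n x y) -> x = y.
Proof.
by move=> xy; apply/funext => i; have [n <-] := e_surj i; exact: (xy n.+1).
Qed.

End Words.

Section UniformMaps.
Variables (I J : Type) (eI : nat -> I) (eJ : nat -> J) (D C : Type).
Implicit Types f : (I -> D) -> (J -> C).

Definition unif_map f := forall n, exists m, forall x y,
  agree eI m x y -> agree eJ n (f x) (f y).

Lemma unif_map_coord f : (forall j, finitary eI (fun x => f x j)) ->
  unif_map f.
Proof.
move=> fc n.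
have [||m fm] := @fin_bound 'I_n (fun k m => forall x y, agree eI m x y ->
    f x (eJ k) = f y (eJ k)); first by move=> k; exact: fc.
  by move=> k a b ab fa x y /(agree_le ab)/fa.
by exists m => x y xy k kn; exact: (fm (Ordinal kn)).
Qed.

Lemma finitary_unif (S : Type) (h : (J -> C) -> S) f :
  unif_map f -> finitary eJ h -> finitary eI (h \o f).
Proof. by move=> fc [n hn]; have [m fm] := fc n; exists m => x y /fm/hn. Qed.

End UniformMaps.

Section WordTopology.
Variables (I : Type) (e : nat -> I) (D : discreteTopologicalType).
Hypothesis e_surj : forall i, exists n, e n = i.
Let W := prod_topology (fun _ : I => D).
Implicit Types (x : W).

Lemma nbhs_agree n x : nbhs x (agree e n x).
Proof.
elim: n => [|n IH].
  by apply: (@filterS _ (nbhs x) _ setT _ _ filterT) => y _ k.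
have nb : nbhs x (fun y : W => x (e n) = y (e n)).
  apply: (@proj_continuous {classic I} (fun=> D) (e n) x).
  by rewrite nbhs_principalE.
apply: (@filterS W (nbhs x) _ _ _ _ (@filterI W (nbhs x) _ _ _ IH nb)) => y.
move=> [xy xyn] k.
by rewrite ltnS leq_eqVlt => /predU1P[->//|]; exact: xy.
Qed.

Lemma nbhs_wordP x (U : set W) :
  nbhs x U <-> exists n, agree e n x `<=` U.
Proof.
split=> [|[n nU]]; last first.
  exact: (@filterS W (nbhs x) _ _ _ nU (nbhs_agree n x)).
pose F : set_system W := filter_from setT (fun n => agree e n x).
have FF : Filter F.
  apply: filter_from_filter; first by exists 0.
  move=> i j _ _; exists (maxn i j) => // y xy.
  by split; apply: agree_le xy; [exact: leq_maxl|exact: leq_maxr].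
suff Fx : F --> x by move=> /Fx[n _ nU]; exists n.
apply/cvg_sup => i V [B [[C oC <-] Cx CV]].
have [n en] := e_surj i; exists n.+1 => // y xy; apply: CV => /=.
suff <- : x i = y i by [].
by rewrite -en; exact: xy.
Qed.

Lemma limit_closedP (X : set W) : closed X <-> limit_closed e X.
Proof.
split=> [cX x xX|cX x xX].
  apply: cX => U /nbhs_wordP[n nU].
  by have [y Xy xy] := xX n; exists y; split=> //; exact: nU.
apply: cX => n; have [y [Xy xy]] := xX _ (nbhs_agree n x).
by exists y.
Qed.

End WordTopology.

(** Koenig's lemma, read off from Tychonoff's theorem. *)
Lemma word_cluster (I : Type) (e : nat -> I) (D : finType)
    (u : nat -> I -> D) :
  exists x, forall n N, exists2 k, N <= k & agree e n x (u k).
Proof.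
pose W := prod_topology (fun _ : I => discrete_topology D).
have cW : compact [set: W].
  have fD : finite_set [set: D] by exact: finite_finset.
  have := @tychonoff {classic I} (fun _ => discrete_topology D) (fun=> setT)
    (fun=> @finite_compact (discrete_topology D) _ fD).
  by congr (compact _); rewrite eqEsubset.
have [|x [_ xu]] := cW (u @ \oo : set_system W); first exact: filterT.
exists (x : I -> D) => n N.
have [||y [[k /= Nk <-] xy]] := xu (u @` [set k | N <= k]) (agree e n x).
- by exists N => // k /= Nk; exists k.
- exact: nbhs_agree.
by exists k.
Qed.

(** Heine's theorem: by compactness the finite window read near each point can
    be chosen uniformly. *)
Lemma locally_finitary (I : Type) (e : nat -> I) (D : finType) (S : Type)
    (f : (I -> D) -> S) :
  (forall x, exists n, forall y, agree e n x y -> f x = f y) -> finitary e f.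
Proof.
move=> fl; apply/not_existsP => nf.
have /choice[u uP] n : exists p : (I -> D) * (I -> D),
    agree e n p.1 p.2 /\ f p.1 <> f p.2.
  have /existsNP[x /existsNP[y /not_implyP xy]] := nf n.
  by exists (x, y).
have [x xu] := word_cluster e (fun n => (u n).1).
have [n fx] := fl x; have [k nk xuk] := xu n n.
have [uk] := uP k; apply; rewrite -(fx _ xuk); apply: fx.
by apply: agree_trans xuk _; exact: agree_le uk.
Qed.

(** * Minimal sets *)

Section MinimalSets.
Variables (G : groupType) (I : Type) (e : nat -> I) (D : finType).
Variable act : G -> (I -> D) -> (I -> D).
Implicit Types (x y : I -> D) (X M : set (I -> D)).

(** Minimality in the form in which it is used: every orbit is dense. *)
Definition orbit_dense X := forall x y n, X x -> X y ->
  exists g, agree e n y (act g x).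

Hypothesis act1 : forall x, act 1 x = x.
Hypothesis actM : forall g h x, act (g * h) x = act g (act h x).
Hypothesis act_unif : forall g, unif_map e e (act g).

Definition cylinder (k : nat) : set (I -> D) := fun x =>
  if @unpickle (seq D) k is Some s then prefix e (size s) x = s :> seq D
  else False.

Definition avoiding X k : set (I -> D) :=
  [set x | X x /\ forall g, ~ cylinder k (act g x)].

Definition shrink X k : set (I -> D) :=
  if pselect (avoiding X k !=set0) then avoiding X k else X.

Lemma cylinder_agree k : exists n, forall x y, agree e n x y ->
  cylinder k x -> cylinder k y.
Proof.
rewrite /cylinder; case: unpickle => [s|]; last by exists 0.
by exists (size s) => x y /prefixP ->.
Qed.

Lemma cylinder_of n y : exists k, cylinder k = agree e n y.
Proof.
exists (pickle (prefix e n y : seq D)); apply/seteqP; split=> x.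
  rewrite /cylinder pickleK size_tuple => xy.
  by apply/prefixP/val_inj; exact: esym xy.
by rewrite /cylinder pickleK size_tuple => /prefixP ->.
Qed.

Definition act_invariant X := forall g x, X x -> X (act g x).

Definition closed_system X :=
  [/\ X !=set0, limit_closed e X & act_invariant X].

Lemma closed_system_shrink X k : closed_system X -> closed_system (shrink X k).
Proof.
move=> [X0 Xc Xi]; rewrite /shrink; case: pselect => // A0; split=> //.
- move=> x xA; split.
    by apply: Xc => n; have [y [Xy _] xy] := xA n; exists y.
  move=> g; have [n cn] := cylinder_agree k; have [m gm] := act_unif g n.
  have [y [_ yk] xy] := xA m.
  by move=> xk; apply: (yk g); apply: cn xk; exact: gm.
- move=> g x [Xx xk]; split; first exact: Xi.
  by move=> h; rewrite -actM; exact: xk.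
Qed.

Lemma shrink_sub X k : shrink X k `<=` X.
Proof. by move=> x; rewrite /shrink; case: pselect => // _ []. Qed.

Lemma nested_nonempty (F : nat -> set (I -> D)) :
  (forall k, F k !=set0) -> (forall k, limit_closed e (F k)) ->
  (forall k, F k.+1 `<=` F k) -> \bigcap_k F k !=set0.
Proof.
move=> /choice[u Fu] Fc Fd.
have Fle i j : i <= j -> F j `<=` F i.
  elim: j => [|j IH]; first by rewrite leqn0 => /eqP ->.
  by rewrite leq_eqVlt => /predU1P[->//|/IH]; apply: subset_trans.
have [x xu] := word_cluster e u; exists x => k _; apply: Fc => n.
by have [j kj xj] := xu n k; exists (u j) => //; exact: Fle (Fu j).
Qed.

(** Cylinders are countably many.  Going through them one by one, the set
    shrinks to the points whose orbit avoids the current cylinder whenever there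
    are any; in the limit, every orbit meets every cylinder that the limit set
    meets. *)
Lemma exists_minimal_set X : closed_system X ->
  exists M, [/\ M `<=` X, closed_system M & orbit_dense M].
Proof.
move=> Xs; pose F := nat_rect (fun=> set (I -> D)) X (fun k Y => shrink Y k).
have Fs k : closed_system (F k).
  by elim: k => //= k; exact: closed_system_shrink.
have F0 k : F k !=set0 by case: (Fs k).
have Fc k : limit_closed e (F k) by case: (Fs k).
have Fi k : act_invariant (F k) by case: (Fs k).
have Fd k : F k.+1 `<=` F k by exact: shrink_sub.
exists (\bigcap_k F k); split.
- by move=> x /(_ 0 Logic.I).
- split; first exact: nested_nonempty.
    move=> x xF k _; apply: Fc => n.
    by have [y Fy xy] := xF n; exists y => //; exact: Fy.
  by move=> g x Fx k _; apply/Fi/Fx.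
- move=> x y n Fx Fy; have [k kE] := cylinder_of n y.
  have := Fx k.+1 Logic.I; have := Fy k.+1 Logic.I.
  rewrite /= /shrink; case: pselect => [? [_ yk]|nA _ _].
    by case: (yk 1); rewrite kE act1.
  apply: contra_notP nA => /forallNP xk; exists x; split=> [|g].
    exact: Fx.
  by rewrite kE; exact: xk.
Qed.

Lemma orbit_dense_sub M X : orbit_dense M -> X `<=` M -> closed_system X ->
  X = M.
Proof.
move=> Md XM [[x Xx] Xc Xi]; apply/seteqP; split=> // y My; apply: Xc => n.
have [g yg] := Md x y n (XM _ Xx) My.
by exists (act g x) => //; exact: Xi.
Qed.

(** The closure of an orbit is a closed invariant subset. *)
Lemma minimal_orbit_dense X : limit_closed e X -> act_invariant X ->
  (forall Y, Y `<=` X -> limit_closed e Y -> Y !=set0 -> act_invariant Y ->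
    Y = X) ->
  orbit_dense X.
Proof.
move=> Xc Xi Xmin x y n Xx Xy.
pose Y := [set z | forall k, exists g, agree e k z (act g x)].
suff /(_ n) : Y y by [].
have -> // : Y = X; apply: Xmin.
- move=> z zY; apply: Xc => k; have [g zg] := zY k.
  by exists (act g x) => //; exact: Xi.
- move=> z zY k; have [w wY zw] := zY k; have [g wg] := wY k.
  by exists g; exact: agree_trans zw wg.
- by exists x => k; exists 1; rewrite act1.
- move=> g z zY k; have [m gm] := act_unif g k; have [h zh] := zY m.
  by exists (g * h); rewrite actM; exact: gm.
Qed.

Definition no_isolated M := forall x n, M x ->
  exists y, [/\ M y, agree e n x y & exists m, ~ agree e m x y].

(** If a point of a minimal set were isolated, every return of its orbit to its
    neighbourhood would fix it; compactness makes infinitely many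
    elements of [G] return, and the action is free. *)
Lemma free_minimal_no_isolated M (c : nat -> G) :
  injective c -> closed_system M -> orbit_dense M ->
  (forall g x, M x -> act g x = x -> g = 1) ->
  (forall i, exists n, e n = i) -> no_isolated M.
Proof.
move=> c_inj [_ Mc Mi] Md Mfree e_surj x n Mx.
apply: contrapT => xisol.
have xE y : M y -> agree e n x y -> y = x.
  move=> My xy; apply: contrapT => yx; apply: xisol; exists y; split=> //.
  apply: contra_notP yx => /forallNP yx.
  by apply: esym; apply: (agree_ext e_surj) => m; apply: contrapT; exact: yx.
have [z zx] := word_cluster e (fun k => act (c k) x).
have Mz : M z.
  apply: Mc => k; have [j _ zj] := zx k 0.
  by exists (act (c j) x) => //; exact: Mi.
have [g xg] := Md z x n Mz Mx; have [m gm] := act_unif g n.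
have ret N : exists2 k, N <= k & c k = g^-1.
  have [k Nk /gm zk] := zx m N; exists k => //.
  apply: (mulgI g); rewrite mulgV; apply: (Mfree _ x) => //.
  rewrite actM; apply: xE; first exact/Mi/Mi.
  exact: agree_trans xg zk.
have [i _ ci] := ret 0; have [j ij cj] := ret i.+1.
suff ijE : i = j by rewrite ijE ltnn in ij.
by apply: c_inj; rewrite ci cj.
Qed.

End MinimalSets.

(** * Back and forth *)

Definition unif_on (I J : Type) (eI : nat -> I) (eJ : nat -> J) (D C : Type)
    (M : set (I -> D)) (f : (I -> D) -> (J -> C)) :=
  forall n, exists m, forall x y, M x -> M y ->
    agree eI m x y -> agree eJ n (f x) (f y).

Section Matchings.
Variables (I J : Type) (eI : nat -> I) (eJ : nat -> J) (D C : finType).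
Variables (M : set (I -> D)) (N : set (J -> C)).
Implicit Types (S : (I -> D) -> (J -> C) -> Prop).

Definition rel_total S := forall x, M x -> exists2 y, N y & S x y.

Definition rel_finitary S := exists m, forall x x' y y',
  agree eI m x x' -> agree eJ m y y' -> S x y -> S x' y'.

Definition rel_separates n S := forall x y y', M x -> N y -> N y' ->
  S x y -> S x y' -> agree eJ n y y'.

(** The decreasing relations [S k] approximate the graph of [f]: the image of
    [x] is a cluster point of approximate images, unique by separation. *)
Lemma rel_limit (S : nat -> (I -> D) -> (J -> C) -> Prop) :
  limit_closed eJ N -> (forall j, exists n, eJ n = j) -> M !=set0 ->
  (forall k, rel_total (S k)) -> (forall k, rel_finitary (S k)) ->
  (forall k x y, M x -> N y -> S k.+1 x y -> S k x y) ->
  (forall k, rel_separates k (S k.+1)) ->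
  exists f, [/\ forall x, M x -> N (f x), forall x k, M x -> S k x (f x),
    forall x y, M x -> N y -> (forall k, S k x y) -> y = f x &
    unif_on eI eJ M f].
Proof.
move=> Nc eJ_surj [x0 Mx0] St Sf Sd Ss; have [y0 _ _] := St 0 _ Mx0.
have Sle i j x y : i <= j -> M x -> N y -> S j x y -> S i x y.
  move=> + Mx Ny; elim: j => [|j IH]; first by rewrite leqn0 => /eqP ->.
  by rewrite leq_eqVlt => /predU1P[->//|/IH] ? /(Sd _ _ _ Mx Ny).
have lim x : exists y, M x -> N y /\ forall k, S k x y.
  have [Mx|nMx] := pselect (M x); last by exists y0.
  have /choice[u uP] k : exists y, N y /\ S k x y.
    by have [y Ny Sy] := St k _ Mx; exists y.
  have [y yu] := word_cluster eJ u.
  exists y => _; split.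
    apply: Nc => n; have [k _ yk] := yu n 0.
    by exists (u k) => //; case: (uP k).
  move=> k; have [m Sm] := Sf k; have [j kj yj] := yu m k.
  have [Nj Sj] := uP j.
  apply: (Sm x _ (u j)); [exact: agree_refl|exact: agree_sym|].
  exact: Sle Sj.
have /choice[f fP] := lim; exists f; split.
- by move=> x /fP[].
- by move=> x k /fP[].
- move=> x y Mx Ny Sxy; have [Nf Sf'] := fP _ Mx.
  by apply: (agree_ext eJ_surj) => n; exact: Ss Mx Ny Nf (Sxy _) (Sf' _).
- move=> n; have [m Sm] := Sf n.+1; exists m => x y Mx My xy.
  have [Nx Sx] := fP _ Mx; have [Ny Sy] := fP _ My.
  apply: Ss My Nx Ny _ (Sy n.+1).
  exact: Sm xy (@agree_refl _ _ _ _ _) (Sx n.+1).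
Qed.

End Matchings.

Section BackAndForth.
Variables (I J : Type) (eI : nat -> I) (eJ : nat -> J) (D C : finType).
Variables (M : set (I -> D)) (N : set (J -> C)).
Implicit Types (S : (I -> D) -> (J -> C) -> Prop).

Definition flip_rel S : (J -> C) -> (I -> D) -> Prop := fun y x => S x y.

Definition matching S := [/\ rel_total M N S, rel_total N M (flip_rel S) &
  rel_finitary eI eJ S].

Definition separating n S := rel_separates eJ M N n S /\
  rel_separates eI N M n (flip_rel S).

(** Approximations are relations rather than pairs of partitions, so that the
    maps [f] and [g] come from one construction applied to [S] and to its
    transpose. The last conclusion keeps track of the approximations, from
    which further properties of [f] are read off. *)
Lemma back_and_forth (P : ((I -> D) -> (J -> C) -> Prop) -> Prop) S0 :
  limit_closed eI M -> limit_closed eJ N ->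
  (forall i, exists n, eI n = i) -> (forall j, exists n, eJ n = j) ->
  M !=set0 ->
  (forall S, P S -> matching S) ->
  (forall S n, P S -> exists S', [/\ P S',
    forall x y, M x -> N y -> S' x y -> S x y & separating n S']) ->
  P S0 ->
  exists f g,
    [/\ forall x, M x -> N (f x) /\ g (f x) = x,
        forall y, N y -> M (g y) /\ f (g y) = y,
        unif_on eI eJ M f, unif_on eJ eI N g &
        (forall x, M x -> S0 x (f x)) /\
        forall n, exists S, [/\ P S, separating n S &
          forall x, M x -> S x (f x)]].
Proof.
move=> Mc Nc eI_surj eJ_surj M0 PM step PS0.
have /choice[nxt nxtP] (Sn : {S | P S} * nat) : exists S' : {S | P S},
    (forall x y, M x -> N y -> sval S' x y -> sval Sn.1 x y) /\
    separating Sn.2 (sval S').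
  have [S' [PS' S'S S'n]] := step _ Sn.2 (proj2_sig Sn.1).
  by exists (exist _ S' PS').
pose T := nat_rect (fun=> {S | P S}) (exist _ S0 PS0) (fun n t => nxt (t, n)).
pose S k := sval (T k).
have PS k : P (S k) by exact: proj2_sig.
have Sd k x y : M x -> N y -> S k.+1 x y -> S k x y.
  exact: (nxtP (T k, k)).1.
have Ss k : separating k (S k.+1) by exact: (nxtP (T k, k)).2.
have N0 : N !=set0.
  have [x Mx] := M0; have [St _ _] := PM _ PS0.
  by have [y Ny _] := St _ Mx; exists y.
have [f [fN fS fu fc]] : exists f, [/\ forall x, M x -> N (f x),
    forall x k, M x -> S k x (f x),
    forall x y, M x -> N y -> (forall k, S k x y) -> y = f x &
    unif_on eI eJ M f].
  apply: rel_limit => // k; first by case: (PM _ (PS k)).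
    by case: (PM _ (PS k)).
  by case: (Ss k).
have [g [gM gS gu gc]] : exists g, [/\ forall y, N y -> M (g y),
    forall y k, N y -> flip_rel (S k) y (g y),
    forall y x, N y -> M x -> (forall k, flip_rel (S k) y x) -> x = g y &
    unif_on eJ eI N g].
  apply: rel_limit => // k; first by case: (PM _ (PS k)).
  - have [_ _ [m Sm]] := PM _ (PS k).
    by exists m => y y' x x' yy' xx'; exact: Sm.
  - by move=> y x Ny Mx; exact: Sd.
  - by case: (Ss k).
exists f, g; split=> //.
- move=> x Mx; split; first exact: fN.
  by apply: esym; apply: gu => //; [exact: fN|move=> k; exact: fS].
- move=> y Ny; split; first exact: gM.
  by apply: esym; apply: fu => //; [exact: gM|move=> k; exact: gS].
split=> [x|n]; first exact: (fS x 0).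
by exists (S n.+1); split=> // x; exact: fS.
Qed.

End BackAndForth.

(** * Homeomorphisms between perfect sets *)

Section PerfectSets.
Variables (J : Type) (e : nat -> J) (C : finType) (N : set (J -> C)).
Hypothesis N_perfect : no_isolated e N.

(** Perfectness yields arbitrarily many distinguishable points near [y]: each
    new point is taken closer to [y] than the level [m] that tells the previous
    ones from [y]. *)
Lemma many_points y j k : N y -> exists p : nat -> J -> C, exists2 m, j <= m &
  (forall i, i < k -> N (p i) /\ agree e j y (p i)) /\
  (forall i i', i < k -> i' < k -> agree e m (p i) (p i') -> i = i').
Proof.
move=> Ny; suff [p [m jm [py pi py']]] : exists p : nat -> J -> C, exists2 m,
    j <= m & [/\ forall i, i < k -> N (p i) /\ agree e j y (p i),
    forall i i', i < k -> i' < k -> agree e m (p i) (p i') -> i = i' &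
    forall i, i < k -> ~ agree e m y (p i)] by exists p, m.
elim: k => [|k [p [m jm [py pi py']]]]; first by exists (fun=> y), j.
have [z [Nz yz [l nyz]]] := N_perfect m Ny.
have zp i : i < k -> ~ agree e m z (p i).
  by move=> /py' yp zp; apply: yp; exact: agree_trans yz zp.
exists (fun i => if i < k then p i else z), (maxn m l).
  by rewrite leq_max jm.
have ml := leq_maxl m l; have lm := leq_maxr m l; split.
- move=> i _; case: ifP => [/py//|_].
  by split=> //; exact: agree_le yz.
- move=> i i'; rewrite !ltnS => ik ik'.
  case: ltnP => ki; case: ltnP => ki'.
  + by move=> /(agree_le ml); exact: pi.
  + by move=> /(agree_le ml)/agree_sym/zp-/(_ ki).
  + by move=> /(agree_le ml)/zp-/(_ ki').
  + by move=> _; apply/eqP; rewrite eqn_leq (leq_trans ik ki') (leq_trans ik').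
- move=> i _; case: ifP => [/py' yp|_]; first by move=> /(agree_le ml).
  by move=> /(agree_le lm).
Qed.

(** Every clopen piece of a perfect set splits into any prescribed finite
    number of nonempty clopen pieces, here indexed by [T a] over the label
    [a]. *)
Lemma perfect_refine (A B : finType) (q : (J -> C) -> A) (T : A -> set B) :
  N !=set0 -> finitary e q -> (forall y, N y -> T (q y) !=set0) ->
  exists q' : (J -> C) -> B, [/\ finitary e q',
    forall y, N y -> T (q y) (q' y) &
    forall y b, N y -> T (q y) b -> exists2 z, N z & q z = q y /\ q' z = b].
Proof.
move=> [y0 Ny0] [j qj] T0; have [b0 _] := T0 _ Ny0.
have /choice[d dT] a : exists b, T a !=set0 -> T a b.
  by have [[b Tb]|nT] := pselect (T a !=set0); [exists b|exists b0].
have /choice[p pP] a : exists p : nat -> J -> C, exists m,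
    (exists2 y, N y & q y = a) ->
    (forall i, i < #|B| -> N (p i) /\ q (p i) = a) /\
    (forall i i', i < #|B| -> i' < #|B| -> agree e m (p i) (p i') -> i = i').
  have [[y Ny <-]|na] := pselect (exists2 y, N y & q y = a); last first.
    by exists (fun=> y0), 0.
  have [p [m jm [py pi]]] := many_points j #|B| Ny.
  exists p, m => _; split=> // i iB; have [Np yp] := py i iB.
  by split=> //; rewrite -(qj y).
have [a m m' mm' pa /pa[py pi]|m mP] := fin_bound pP.
  by split=> // i i' iB i'B /(agree_le mm'); exact: pi.
pose hits y b := T (q y) b /\ agree e m y (p (q y) (enum_rank b)).
pose q' y := if pselect (exists b, hits y b) is left yb then sval (cid yb)
  else d (q y).
have q'T y : N y -> T (q y) (q' y).
  move=> Ny; rewrite /q'; case: pselect => [yb|_]; last exact/dT/T0.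
  by case: cid => b [].
exists q'; split=> // [|y b Ny Tb].
  exists (maxn j m) => x y xy.
  have xyq : q x = q y by apply/qj/(agree_le _ xy)/leq_maxl.
  suff xyh : hits x = hits y by rewrite /q' xyh xyq.
  have xym : agree e m x y by apply/(agree_le _ xy)/leq_maxr.
  apply/funext => b; rewrite /hits xyq; apply/propext; split=> -[Tb xb].
    by split=> //; apply: agree_trans xb; exact: agree_sym.
  by split=> //; exact: agree_trans xb.
have [|pN pi] := mP (q y); first by exists y.
have rB (c : B) : enum_rank c < #|B| by exact: ltn_ord.
have [Np qp] := pN _ (rB b); exists (p (q y) (enum_rank b)) => //; split=> //.
rewrite /q'; case: pselect => [yb|[]]; last by exists b; rewrite /hits qp.
case: cid => c [/= _]; rewrite qp => /pi bc.
by apply: enum_rank_inj; apply: val_inj; rewrite /= bc.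
Qed.

End PerfectSets.

Section PerfectHomeo.
Variables (I J : Type) (eI : nat -> I) (eJ : nat -> J) (D C : finType).
Variables (M : set (I -> D)) (N : set (J -> C)).

Definition same_image (A : Type) (p : (I -> D) -> A) (q : (J -> C) -> A) :=
  (forall x, M x -> exists2 y, N y & p x = q y) /\
  (forall y, N y -> exists2 x, M x & p x = q y).

Lemma same_image_matching (A : Type) (p : (I -> D) -> A) (q : (J -> C) -> A) :
  finitary eI p -> finitary eJ q -> same_image p q ->
  matching eI eJ M N (fun x y => p x = q y).
Proof.
move=> [i pi] [j qj] [pq qp]; split=> //.
exists (maxn i j) => x x' y y' xx' yy'.
rewrite (pi x x'); last exact/(agree_le _ xx')/leq_maxl.
by rewrite (qj y y'); last exact/(agree_le _ yy')/leq_maxr.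
Qed.

Lemma same_image_refine (A B : finType) (p : (I -> D) -> A) (q : (J -> C) -> A)
    (p' : (I -> D) -> B) :
  no_isolated eJ N -> N !=set0 -> finitary eJ q -> same_image p q ->
  exists2 q' : (J -> C) -> B, finitary eJ q' &
    same_image (fun x => (p x, p' x)) (fun y => (q y, q' y)).
Proof.
move=> Np N0 qf [pq qp].
have [y /qp[x Mx xy]|q' [q'f q'1 q'2]] := @perfect_refine _ _ _ _ Np _ _ q
    (fun a => [set b | exists2 x, M x & p x = a /\ p' x = b]) N0 qf.
  by exists (p' x), x.
exists q' => //; split=> [x Mx|y /q'1[x Mx [px p'x]]]; last first.
  by exists x => //; rewrite px p'x.
have [y Ny pxy] := pq _ Mx; have [|z Nz [qz q'z]] := q'2 y (p' x) Ny.
  by exists x.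
by exists z => //; rewrite q'z qz pxy.
Qed.

End PerfectHomeo.

Lemma same_imageC (I J : Type) (D C : finType) (M : set (I -> D))
    (N : set (J -> C)) (A : Type) (p : (I -> D) -> A) (q : (J -> C) -> A) :
  same_image M N p q -> same_image N M q p.
Proof.
by move=> [pq qp]; split=> [y /qp[x Mx]|x /pq[y Ny]]; [exists x|exists y].
Qed.

(** Brouwer's characterization of the Cantor space, in a form where the
    homeomorphism respects given clopen partitions.  Refining one side by its
    prefixes can always be matched on the other side, since perfect pieces
    split at will. *)
Lemma perfect_homeo (I J : Type) (eI : nat -> I) (eJ : nat -> J)
    (D C : finType) (M : set (I -> D)) (N : set (J -> C))
    (A : finType) (p : (I -> D) -> A) (q : (J -> C) -> A) :
  (forall i, exists n, eI n = i) -> (forall j, exists n, eJ n = j) ->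
  limit_closed eI M -> limit_closed eJ N -> M !=set0 -> N !=set0 ->
  no_isolated eI M -> no_isolated eJ N ->
  finitary eI p -> finitary eJ q -> same_image M N p q ->
  exists f g,
    [/\ forall x, M x -> N (f x) /\ g (f x) = x,
        forall y, N y -> M (g y) /\ f (g y) = y,
        unif_on eI eJ M f, unif_on eJ eI N g &
        forall x, M x -> p x = q (f x)].
Proof.
move=> eI_surj eJ_surj Mc Nc M0 N0 Mp Np pf qf pq.
pose P S := exists (A' : finType) (p' : (I -> D) -> A') (q' : (J -> C) -> A'),
  [/\ finitary eI p', finitary eJ q', same_image M N p' q' &
    S = (fun x y => p' x = q' y)].
have [|S n [B [r [s [rf sf rs ->]]]]||f [g [fN gM fc gc [fS _]]]] :=
    @back_and_forth _ _ eI eJ _ _ M N P (fun x y => p x = q y)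
      Mc Nc eI_surj eJ_surj M0; last by exists f, g.
- by move=> _ [B [r [s [rf sf rs ->]]]]; exact: same_image_matching.
- have nI := @finitary_prefix _ eI D n.
  have nJ := @finitary_prefix _ eJ C n.
  have [s' s'f rs'] := same_image_refine (prefix eI n) Np N0 sf rs.
  have [r' r'f rs2] := same_image_refine (prefix eJ n) Mp M0
    (finitary_pair rf nI) (same_imageC rs').
  exists (fun x y => (r x, prefix eI n x, r' x) = (s y, s' y, prefix eJ n y)).
  split.
  + exists (B * n.-tuple D * n.-tuple C)%type.
    exists (fun x => (r x, prefix eI n x, r' x)).
    exists (fun y => (s y, s' y, prefix eJ n y)); split=> //.
    * exact/finitary_pair/r'f/finitary_pair.
    * exact/finitary_pair/nJ/finitary_pair.
    * exact: same_imageC rs2.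
  + by move=> x y _ _ [].
  + by split=> x y y' _ _ _ [_ xy yx] [_ xy' yx'];
       apply/prefixP; congruence.
- by exists A, p, q.
Qed.

(** * Minimal actions on the Cantor space *)

Section CantorActions.
Variable G : groupType.
Implicit Types (xi eta zeta : Xi_min G) (g h : G) (x y : nat -> bool).

Definition act xi g : (nat -> bool) -> (nat -> bool) :=
  homeo_fun (Xi_fun (Xi_min_val xi) g).

Lemma nat_surj (i : nat) : exists n : nat, id n = i.
Proof. by exists i. Qed.

Lemma cantor_nbhsP (x : cantor_space) (U : set cantor_space) :
  nbhs x U <-> exists n, agree id n x `<=` U.
Proof. exact: (@nbhs_wordP nat id bool nat_surj x U). Qed.

Lemma cantor_closedP (X : set cantor_space) : closed X <-> limit_closed id X.
Proof. exact: (@limit_closedP nat id bool nat_surj X). Qed.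

Lemma cantor_continuousP (f : cantor_space -> cantor_space) :
  continuous f <-> unif_map id id f.
Proof.
split=> [fc|fu x U /cantor_nbhsP[n nU]].
  apply: unif_map_coord => j; apply: locally_finitary => x.
  have /fc/cantor_nbhsP[n nU] : nbhs (f x) [set y : cantor_space | f x j = y j].
    by apply/cantor_nbhsP; exists j.+1 => y; apply.
  by exists n.
apply/cantor_nbhsP; have [m fm] := fu n.
by exists m => y /fm xy; exact: nU.
Qed.

Lemma act1 xi x : act xi 1 x = x.
Proof. by rewrite /act; have [-> _] := Xi_funP (Xi_min_val xi). Qed.

Lemma actM xi g h x : act xi (g * h) x = act xi g (act xi h x).
Proof. by rewrite /act; have [_ ->] := Xi_funP (Xi_min_val xi). Qed.

Lemma act_unif xi g : unif_map id id (act xi g).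
Proof.
apply/cantor_continuousP.
by have [k []] := homeo_funP (Xi_fun (Xi_min_val xi) g).
Qed.

Lemma act_minimal xi : orbit_dense id (act xi) setT.
Proof.
apply: minimal_orbit_dense.
- exact: act1.
- exact: actM.
- exact: act_unif.
- by [].
- by [].
move=> Y Ys Yc Y0 Yi; have := set_mem (valP xi); apply=> //.
exact/cantor_closedP.
Qed.

(** The way all minimal actions are built below: homeomorphisms are obtained
    from the action law, the inverse of [a g] being [a g^-1]. *)
Lemma exists_minimal_action (a : G -> (nat -> bool) -> (nat -> bool)) :
  (forall x, a 1 x = x) -> (forall g h x, a (g * h) x = a g (a h x)) ->
  (forall g, unif_map id id (a g)) -> orbit_dense id a setT ->
  exists xi, act xi = a.
Proof.
move=> a1 aM au ad.
have ah g : is_homeo (a g : cantor_space -> cantor_space).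
  exists (a g^-1); split.
  - by move=> x; rewrite -aM mulVg a1.
  - by move=> x; rewrite -aM mulgV a1.
  - exact/cantor_continuousP.
  - exact/cantor_continuousP.
pose f : {ptws G -> Homeo cantor_space} := fun g => mk_homeo (ah g).
have fm : monoid_morphism f.
  split=> [|g h]; apply: homeo_eqP => x; first exact: a1.
  exact: aM.
pose xi : Xi G := exist _ f (mem_set fm).
have ximin : minimal_action xi.
  move=> Y _ /cantor_closedP Yc Y0 Yi.
  by apply: (@orbit_dense_sub G nat id bool a) => //; split.
by exists (exist _ xi (mem_set ximin)).
Qed.

End CantorActions.

(** * The topology of the space of minimal actions *)

Lemma coord_entourage n :
  entourage [set p : cantor_space * cantor_space | p.1 n = p.2 n].
Proof.
set E := [set p | _].
have entE : `[< @entourage (initial_topology (@proj nat (fun=> bool) n)) E >].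
  apply/asboolP; exists [set p : bool * bool | p.1 = p.2]; last by case.
  by rewrite uniform_discrete => _ [b _ <-].
exists E => //; exists [fset (exist _ (n : {classic nat}, E) entE)]%fset.
  by move=> p _; exact: in_setT.
apply/seteqP; split=> [p|p Ep q]; last by rewrite /= inE => /eqP ->.
by move=> /(_ (exist _ (n : {classic nat}, E) entE)); apply; rewrite /= inE.
Qed.

Lemma agree_entourage n :
  entourage [set p : cantor_space * cantor_space | agree id n p.1 p.2].
Proof.
elim: n => [|n IH]; first by apply: filterS filterT => p _ k.
apply: filterS (filterI IH (coord_entourage n)) => -[x y] [/= xy xyn] k.
by rewrite ltnS leq_eqVlt => /predU1P[->//|]; exact: xy.
Qed.

(** Compactness: otherwise pairs that agree more and more but lie outside [E]
    would cluster at a point of the diagonal. *)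
Lemma entourage_agree (E : set (cantor_space * cantor_space)) : entourage E ->
  exists n, forall x y, agree id n x y -> E (x, y).
Proof.
move=> entE; apply/not_existsP => nE.
have /choice[u uP] n : exists p : cantor_space * cantor_space,
    agree id n p.1 p.2 /\ ~ E p.
  have /existsNP[x /existsNP[y /not_implyP xy]] := nE n.
  by exists (x, y).
have [x xu] := word_cluster id (fun n => (u n).1).
have /cantor_nbhsP[n nV] : nbhs (x : cantor_space)
    (xsection (split_ent E `&` (split_ent E)^-1)%relation (x : cantor_space)).
  apply: nbhs_entourage; apply: filterI; first exact: entourage_split_ent.
  by apply: entourage_inv; exact: entourage_split_ent.
have [k nk xk] := xu n n; have [uk nEk] := uP k; apply: nEk.
have /xsectionP[_ /= xu1] := nV _ xk.
have /xsectionP[xu2 _] : xsection (split_ent E `&` (split_ent E)^-1)%relation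
   (x : cantor_space) (u k).2.
  by apply: nV; apply: agree_trans xk _; exact: agree_le uk.
case: (u k) xu1 xu2 => a b /= xa xb.
exact: (@entourage_split cantor_space x a b E).
Qed.

Section XiTopology.
Variables (G : groupType) (e : nat -> G).
Hypothesis e_surj : forall g, exists n, e n = g.
Implicit Types (xi eta zeta : Xi_min G) (g h : G).

Definition close n xi eta :=
  forall k, k < n -> forall x, agree id n (act xi (e k) x) (act eta (e k) x).

Lemma close_sym n xi eta : close n xi eta -> close n eta xi.
Proof. by move=> xe k kn x; apply: agree_sym; exact: xe. Qed.

Lemma close_trans n eta xi zeta :
  close n xi eta -> close n eta zeta -> close n xi zeta.
Proof. by move=> xe ez k kn x; apply: agree_trans (xe k kn x) (ez k kn x). Qed.

Lemma close_le n m xi eta : m <= n -> close n xi eta -> close m xi eta.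
Proof.
by move=> mn xe k km x; apply/(agree_le mn)/xe; exact: leq_trans mn.
Qed.

Lemma close_act g m : exists n, forall xi eta, close n xi eta ->
  forall x, agree id m (act xi g x) (act eta g x).
Proof.
have [i <-] := e_surj g; exists (maxn m i.+1) => xi eta xe x.
by apply: agree_le (leq_maxl m i.+1) _; apply: xe; exact: leq_maxr.
Qed.

Lemma act_continuous g :
  continuous (fun xi => act xi g : {uniform cantor_space -> cantor_space}).
Proof.
move=> xi.
apply: (@continuous_comp _ _ _ (fun xi => Xi_fun (Xi_min_val xi) g)
  (fun h : Homeo cantor_space =>
    homeo_fun h : {uniform cantor_space -> cantor_space})); last first.
  exact: initial_continuous.
apply: (@continuous_comp _ _ _ (fun xi => Xi_min_val xi)
  (fun xi : Xi G => Xi_fun xi g)); first exact: initial_continuous.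
apply: (@continuous_comp (Xi G) {ptws G -> Homeo cantor_space}
  (Homeo cantor_space) (@Xi_fun G) (fun f => f g)).
  exact: initial_continuous.
exact: (@proj_continuous {classic G} (fun=> Homeo cantor_space)).
Qed.

Lemma close_nbhs n xi : nbhs xi (close n xi).
Proof.
have nb m g : nbhs xi (fun eta => forall x,
    agree id m (act xi g x) (act eta g x)).
  pose V : set {uniform cantor_space -> cantor_space} :=
    fun f => forall x, agree id m (act xi g x) (f x).
  suff nV : nbhs (act xi g : {uniform cantor_space -> cantor_space}) V.
    exact: act_continuous nV.
  apply/uniform_nbhs; exists [set p | agree id m p.1 p.2].
  split; first exact: agree_entourage.
  by move=> h /= xh x; exact: xh.
have nbk : forall k, nbhs xi (fun eta => forall i, i < k -> forall x,
    agree id n (act xi (e i) x) (act eta (e i) x)).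
  elim=> [|k IH]; first by apply: filterS filterT.
  apply: filterS (filterI IH (nb n (e k))) => eta [xe xek] i.
  by rewrite ltnS leq_eqVlt => /predU1P[->//|]; exact: xe.
exact: nbk.
Qed.

Lemma nbhs_close xi (U : set (Xi_min G)) : nbhs xi U ->
  exists n, close n xi `<=` U.
Proof.
move=> [_ [[O oO <-] Oxi OU]]; case: oO Oxi OU => O' oO' <- Oxi OU.
pose F : set_system {ptws G -> Homeo cantor_space} :=
  filter_from setT
    (fun n => (fun eta => Xi_fun (Xi_min_val eta)) @` close n xi).
have FF : Filter F.
  apply: filter_from_filter; first by exists 0.
  move=> i j _ _; exists (maxn i j) => // _ [eta xe <-].
  by split; exists eta => //; apply: close_le xe;
    [exact: leq_maxl|exact: leq_maxr].
suff Fxi : F --> (Xi_fun (Xi_min_val xi) : {ptws G -> Homeo cantor_space}).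
  have [|n _ nO] := Fxi O'; first exact: open_nbhs_nbhs.
  by exists n => eta xe; apply: OU; apply: nO; exists eta.
apply/cvg_sup => g V [_ [[C oC <-] Cxi CV]].
case: oC Cxi CV => C' oC' <- Cxi CV.
have /uniform_nbhs[E [entE EC]] : nbhs
    (act xi g : {uniform cantor_space -> cantor_space}) C'.
  exact: open_nbhs_nbhs.
have [n nE] := entourage_agree entE; have [m mn] := close_act g n.
exists m => // _ [eta /mn xe <-]; apply: CV => /=; apply: EC => x _.
exact/nE/xe.
Qed.

End XiTopology.

(** * Minimal subshifts and the Vietoris topology *)

Lemma vietoris_open (T : topologicalType) (i : bool * set T) : open i.2 ->
  open (vietoris_subbase i : set (vietoris T)).
Proof.
move=> oi; exists [set vietoris_subbase i]; last first.
  by rewrite predeqE => Z; split=> [[_ ->]|] //; exists (vietoris_subbase i).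
move=> _ ->; exists [fset i]%fset.
  by move=> j; rewrite in_fset1 => /eqP ->; exact: mem_set.
rewrite predeqE => Z; split=> [|Zi j]; first by apply; rewrite /= inE.
by rewrite /= inE => /eqP ->.
Qed.

(** Convergence needs checking only on the two kinds of subbasic sets. *)
Lemma vietoris_cvg (T : topologicalType) (F : set_system (vietoris T))
    (X : vietoris T) : Filter F ->
  (forall O : set T, open O -> X `<=` O -> F [set Z | Z `<=` O]) ->
  (forall O : set T, open O -> X `&` O !=set0 -> F [set Z | Z `&` O !=set0]) ->
  F --> X.
Proof.
move=> FF Fsub Fmeet U; rewrite /= nbhsE => -[_ [[B sB <-] [C BC CX] sU]].
rewrite nbhs_filterE; apply: filterS sU _; apply: (@filterS _ _ _ C).
  by move=> ? ?; exists C.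
have [D sD DC] := sB _ BC; rewrite -DC; apply: filter_bigI => -[b O] iD.
have oO : open O by exact: set_mem (sD _ iD).
have XbO : vietoris_subbase (b, O) X by move: CX; rewrite -DC => /(_ _ iD).
by case: b iD XbO => iD /= XbO; [exact: Fsub|exact: Fmeet].
Qed.

Section SubshiftSpaces.
Variables (G : groupType) (e : nat -> G) (A : finType).
Hypothesis e_surj : forall g, exists n, e n = g.
Implicit Types (x y : G -> A).

Definition shift_word (g : G) x : G -> A := fun h => x (g^-1 * h).

Lemma shift_word1 x : shift_word 1 x = x.
Proof. by apply/funext => h; rewrite /shift_word invg1 mul1g. Qed.

Lemma shift_wordM g h x :
  shift_word (g * h) x = shift_word g (shift_word h x).
Proof. by apply/funext => k; rewrite /shift_word invgM mulgA. Qed.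

Lemma shift_word_unif g : unif_map e e (shift_word g).
Proof. by apply: unif_map_coord => h; exact: finitary_coord. Qed.

Definition minimal_system (X : set (G -> A)) :=
  closed_system e shift_word X /\ orbit_dense e shift_word X.

Definition same_patterns n (X Y : set (G -> A)) :=
  (forall x, X x -> exists2 y, Y y & agree e n x y) /\
  (forall y, Y y -> exists2 x, X x & agree e n x y).

Lemma same_patterns_le n m (X Y : set (G -> A)) : m <= n ->
  same_patterns n X Y -> same_patterns m X Y.
Proof.
move=> mn [XY YX]; split=> z.
  by move=> /XY[w Yw /(agree_le mn) zw]; exists w.
by move=> /YX[w Xw /(agree_le mn) zw]; exists w.
Qed.

Lemma shift_closedP (X : set (full_shift G A)) :
  closed X <-> limit_closed e X.
Proof. exact: (@limit_closedP _ e (discrete_topology A)). Qed.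

Lemma shift_nbhsP (x : full_shift G A) (U : set (full_shift G A)) :
  nbhs x U <-> exists n, agree e n x `<=` U.
Proof. exact: (@nbhs_wordP _ e (discrete_topology A)). Qed.

Lemma minimal_subshift_system (X : minimal_subshifts G A) :
  minimal_system (minimal_subshift_set X).
Proof.
have [X0 /shift_closedP Xc Xi] := set_mem (valP (val X)).
have Xm := set_mem (valP X); split=> //.
apply: minimal_orbit_dense => //.
- exact: shift_word1.
- exact: shift_wordM.
- exact: shift_word_unif.
by move=> Y YX /shift_closedP Yc Y0 Yi; exact: Xm.
Qed.

Lemma minimal_system_subshift X : minimal_system X ->
  exists Y : minimal_subshifts G A, minimal_subshift_set Y = X.
Proof.
move=> [[X0 Xc Xi] Xd].
have Xs : is_subshift (X : set (full_shift G A)).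
  by split=> //; exact/shift_closedP.
pose S : subshifts G A := exist _ (X : vietoris _) (mem_set Xs).
have Xm : minimal_on (@shift G A) (subshift_set S).
  move=> Y YX /shift_closedP Yc Y0 Yi.
  exact: (orbit_dense_sub Xd).
by exists (exist _ S (mem_set Xm)).
Qed.

Lemma cylinder_open n x : open (agree e n x : set (full_shift G A)).
Proof.
rewrite openE => y xy; apply/shift_nbhsP; exists n => z.
exact: agree_trans xy.
Qed.

Lemma minimal_subshift_nbhs (i : bool * set (full_shift G A))
    (X : minimal_subshifts G A) :
  open i.2 -> vietoris_subbase i (minimal_subshift_set X) ->
  nbhs X [set Y | vietoris_subbase i (minimal_subshift_set Y)].
Proof.
move=> /vietoris_open oi Xi; apply: open_nbhs_nbhs; split=> //.
exists ((fun Y : subshifts G A => subshift_set Y) @^-1` vietoris_subbase i);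
  last by [].
by exists (vietoris_subbase i).
Qed.

(** Having at most the patterns of [X] is a condition of the first subbasic
    kind, and each pattern of [X], among finitely many, is required by a
    condition of the second kind. *)
Lemma same_patterns_nbhs n (X : minimal_subshifts G A) :
  nbhs X [set Y | same_patterns n (minimal_subshift_set X)
                               (minimal_subshift_set Y)].
Proof.
pose O : set (full_shift G A) :=
  \bigcup_(x in minimal_subshift_set X) agree e n x.
have oO : open O by apply: bigcup_open => x _; exact: cylinder_open.
have XO : vietoris_subbase (true, O) (minimal_subshift_set X).
  by move=> x Xx; exists x.
have meet (t : n.-tuple A) : nbhs X [set Y | forall x,
    minimal_subshift_set X x -> prefix e n x = t ->
    exists2 y, minimal_subshift_set Y y & agree e n x y].
  have [[x Xx <-]|nt] :=
      pselect (exists2 x, minimal_subshift_set X x & prefix e n x = t).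
    have := @minimal_subshift_nbhs (false, agree e n x) X (cylinder_open n x).
    move=> /(_ (ex_intro _ x (conj Xx (@agree_refl _ _ _ _ _)))).
    apply: filterS => Y [y [Yy xy]] x' _ /prefixP x'x; exists y => //.
    exact: agree_trans x'x xy.
  by apply: filterS filterT => Y _ x Xx xt; case: nt; exists x.
have sub := @minimal_subshift_nbhs (true, O) X oO XO.
have {}meet := @filter_forall _ _ _ (nbhs X) (nbhs_filter X) meet.
apply: filterS (filterI sub meet) => Y [YO XY].
split=> [x Xx|y /YO[x Xx xy]]; last by exists x.
exact: XY Xx erefl.
Qed.

Lemma nbhs_same_patterns (X : minimal_subshifts G A)
    (U : set (minimal_subshifts G A)) : nbhs X U ->
  exists n, forall Y, same_patterns n (minimal_subshift_set X)
                               (minimal_subshift_set Y) -> U Y.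
Proof.
move=> [_ [[O oO <-] OX OU]]; case: oO OX OU => O' oO' <- OX OU.
pose F : set_system (vietoris (full_shift G A)) := filter_from setT (fun n =>
  [set Z | same_patterns n (minimal_subshift_set X) Z]).
have FF : Filter F.
  apply: filter_from_filter; first by exists 0.
  move=> i j _ _; exists (maxn i j) => // Z XZ.
  by split; apply: same_patterns_le XZ; [exact: leq_maxl|exact: leq_maxr].
suff FX : F --> (minimal_subshift_set X : vietoris _).
  have [|n _ nO] := FX O'; first exact: open_nbhs_nbhs.
  by exists n => Y XY; apply: OU; exact: (nO (minimal_subshift_set Y)).
have [[_ Xc _] _] := minimal_subshift_system X.
apply: vietoris_cvg => O1 oO1 XO.
- apply: contrapT => nF; have /choice[z zP] n : exists z,
      (exists2 x, minimal_subshift_set X x & agree e n x z) /\ ~ O1 z.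
    apply: contrapT => nz; apply: nF; exists n => // Z [_ ZX] z /ZX xz.
    by apply: contrapT => nOz; apply: nz; exists z.
  have [y yz] := word_cluster e z.
  have /XO Oy : minimal_subshift_set X y.
    apply: Xc => n; have [k nk yk] := yz n n; have [[x Xx xz] _] := zP k.
    exists x => //; apply: agree_trans yk _; apply: agree_sym.
    exact: agree_le xz.
  have [|n nO] := (iffLR (shift_nbhsP y O1)); first exact: open_nbhs_nbhs.
  by have [k _ yk] := yz n 0; have [_] := zP k; apply; exact: nO.
- have [y [Xy Oy]] := XO.
  have [|n nO] := (iffLR (shift_nbhsP y O1)); first exact: open_nbhs_nbhs.
  by exists n => // Z [/(_ _ Xy)[z Zz yz] _]; exists z; split=> //; exact: nO.
Qed.

End SubshiftSpaces.

(** * Symbolic factors *)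

Lemma one_below (G : groupType) (e : nat -> G) : bijective e ->
  forall n, exists2 m, n <= m & exists2 i, i < m & e i = 1.
Proof.
move=> e_bij n; have [i ei] := bij_surj e_bij 1.
exists (maxn n i.+1); first exact: leq_maxl.
by exists i => //; exact: leq_maxr.
Qed.

Section Codes.
Variables (G : groupType) (e : nat -> G).
Hypothesis e_bij : bijective e.
Implicit Types (xi eta zeta : Xi_min G) (x y : nat -> bool).

Let e_surj := bij_surj e_bij.

(** The inverse makes the coding equivariant for the left shift. *)
Definition code (A : Type) (a : (nat -> bool) -> A) xi x : G -> A :=
  fun h => a (act xi h^-1 x).

Definition symbolic_factor (A : Type) (a : (nat -> bool) -> A) xi :
  set (G -> A) := range (code a xi).

Lemma code_act (A : finType) (a : (nat -> bool) -> A) xi g x :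
  code a xi (act xi g x) = shift_word g (code a xi x).
Proof.
by apply/funext => h; rewrite /code /shift_word -actM invgM invgK.
Qed.

Lemma code1 (A : Type) (a : (nat -> bool) -> A) xi x : code a xi x 1 = a x.
Proof. by rewrite /code invg1 act1. Qed.

Lemma code_unif (A : finType) (a : (nat -> bool) -> A) xi : finitary id a ->
  unif_map id e (code a xi).
Proof.
move=> af; apply: unif_map_coord => h.
by apply: (finitary_unif (h := a)) af; exact: act_unif.
Qed.

(** The factor is the image of a minimal system by an equivariant continuous
    map; it is closed by compactness. *)
Lemma symbolic_factor_system (A : finType) (a : (nat -> bool) -> A) xi :
  finitary id a -> minimal_system e (symbolic_factor a xi).
Proof.
move=> af; have cu := code_unif xi af; split; first split.
- by exists (code a xi (fun=> false)); exists (fun=> false).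
- move=> z zc; have /choice[u uz] n : exists x, agree e n z (code a xi x).
    by have [_ [x _ <-] zx] := zc n; exists x.
  have [x xu] := word_cluster id u; exists x => //.
  apply: (agree_ext e_surj) => n; have [m cm] := cu n.
  have [k nk xk] := xu m n; apply: agree_trans (cm _ _ xk) _.
  by apply: agree_sym; exact: agree_le (uz k).
- by move=> g _ [x _ <-]; exists (act xi g x) => //; exact: code_act.
- move=> _ _ n [x _ <-] [y _ <-]; have [m cm] := cu n.
  have [g yg] := @act_minimal G xi x y m Logic.I Logic.I.
  by exists g; rewrite -code_act; exact: cm.
Qed.

End Codes.

(** * Realizing minimal subshifts as symbolic factors *)

Lemma cantor_no_isolated : no_isolated id [set: nat -> bool].
Proof.
move=> x n _; exists (fun k => (k == n) (+) x k); split=> //.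
  by move=> k kn; rewrite /= ltn_eqF.
by exists n.+1 => /(_ n (ltnSn n)) /=; rewrite eqxx; case: (x n).
Qed.

Lemma third_color (a b : 'I_3) : exists c : 'I_3, c != a /\ c != b.
Proof.
have /card_gt0P[c] : 0 < #|~: [set a; b]%SET|.
  rewrite -(ltn_add2l #|[set a; b]%SET|) cardsC card_ord cards2.
  by case: (a != b).
by rewrite !inE negb_or => /andP[ca cb]; exists c.
Qed.

(** The graph joining [h] to [h * g] has degree at most two, so coloring the
    group greedily along an enumeration never needs a fourth color. *)
Lemma three_coloring (G : groupType) (e : nat -> G) (g : G) :
  bijective e -> g <> 1 -> exists c : G -> 'I_3, forall h, c (h * g) <> c h.
Proof.
move=> [idx eK idxK] g1.
have /choice[pick pickP] (ab : 'I_3 * 'I_3) := third_color ab.1 ab.2.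
pose next n (s : seq 'I_3) := pick (nth ord0 s (idx (e n * g)),
                                    nth ord0 s (idx (e n * g^-1))).
pose s := nat_rect (fun=> seq 'I_3) [::] (fun n t => rcons t (next n t)).
have size_s n : size (s n) = n by elim: n => //= n IH; rewrite size_rcons IH.
pose color n := next n (s n).
have sE m n : n < m -> nth ord0 (s m) n = color n.
  elim: m => //= m IH; rewrite ltnS nth_rcons size_s leq_eqVlt.
  by move=> /predU1P[->|nm]; rewrite ?ltnn ?eqxx// nm IH.
have colorP n m : m < n -> m = idx (e n * g) \/ m = idx (e n * g^-1) ->
    color n <> color m.
  move=> mn; have [/eqP c1 /eqP c2] := pickP (nth ord0 (s n) (idx (e n * g)),
                                    nth ord0 (s n) (idx (e n * g^-1))).
  by rewrite -(sE n m)// => -[->|->]; rewrite /color.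
exists (fun h => color (idx h)) => h.
have [lt|lt|/(congr1 e)] := ltngtP (idx h) (idx (h * g)).
- by apply: colorP => //; right; rewrite idxK mulgK.
- by apply/nesym/colorP => //; left; rewrite idxK.
- by rewrite !idxK -[LHS]mulg1 => /mulgI/esym.
Qed.

Section Realization.
Variables (G : groupType) (e : nat -> G).
Hypothesis e_bij : bijective e.

Let e_surj := bij_surj e_bij.

Let e2 (n : nat) : G * G :=
  if unpickle n is Some (i, j) then (e i, e j) else (1, 1).

Let e2_surj p : exists n, e2 n = p.
Proof.
case: p => g h; have [i <-] := e_surj g; have [j <-] := e_surj h.
by exists (pickle (i, j)); rewrite /e2 pickleK.
Qed.

Definition row_shift (T : Type) (k : G) (w : G * G -> T) : G * G -> T :=
  fun p => w (p.1, k^-1 * p.2).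

(** The row of index [1] carries a point of [Y], and the row of index [g] a
    coloring that [g] cannot preserve. *)
Definition free_cover (B : Type) (Y : set (G -> B)) : set (G * G -> B * 'I_3) :=
  [set w | Y (fun h => (w (1, h)).1) /\
    forall g h, g <> 1 -> (w (g, h * g)).2 <> (w (g, h)).2].

Section FreeCover.
Variables (B : finType) (Y : set (G -> B)).
Let row (w : G * G -> B * 'I_3) : G -> B := fun h => (w (1, h)).1.

Lemma row_unif : unif_map e2 e row.
Proof.
apply: unif_map_coord => h.
by apply: (finitary_comp fst); exact: finitary_coord.
Qed.

Lemma row_shift1 (w : G * G -> B * 'I_3) : row_shift 1 w = w.
Proof. by apply/funext => -[g h]; rewrite /row_shift invg1 mul1g. Qed.

Lemma row_shiftM k l (w : G * G -> B * 'I_3) :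
  row_shift (k * l) w = row_shift k (row_shift l w).
Proof. by apply/funext => p; rewrite /row_shift invgM mulgA. Qed.

Lemma row_shift_unif k :
  unif_map e2 e2 (@row_shift (B * 'I_3) k).
Proof. by apply: unif_map_coord => p; exact: finitary_coord. Qed.

(** If [k] fixed [w], the row of index [k] would give [k^-1] and [1] the same
    color, against the coloring condition at [h = k^-1]. *)
Lemma row_shift_free k w : free_cover Y w -> row_shift k w = w -> k = 1.
Proof.
move=> [_ wc] wk; apply: contrapT => /(wc k (k^-1)); rewrite mulVg.
by rewrite -{1}wk /row_shift /= mulg1.
Qed.

Lemma free_cover_system : minimal_system e Y ->
  closed_system e2 (@row_shift (B * 'I_3)) (free_cover Y).
Proof.
move=> [[[y0 Yy0] Yc Yi] _]; split.
- have /choice[c cP] g : exists c : G -> 'I_3, g <> 1 -> forall h,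
      c (h * g) <> c h.
    have [g1|g1] := pselect (g <> 1); last by exists (fun=> ord0).
    by have [c ?] := three_coloring e_bij g1; exists c.
  exists (fun p => (y0 p.2, c p.1 p.2)); split=> // g h g1.
  exact: cP.
- move=> w wc; split.
    apply: Yc => n; have [m rm] := row_unif n; have [v [Yv _] wv] := wc m.
    by exists (row v) => //; exact: rm.
  move=> g h g1; have [n cn] := finitary_pair
    (finitary_coord (B * 'I_3) e2_surj (g, h * g))
    (finitary_coord (B * 'I_3) e2_surj (g, h)).
  have [v [_ vc] wv] := wc n; have [-> ->] := cn _ _ wv.
  exact: vc.
- move=> k w [Yw wc]; split; first exact: (Yi k _ Yw).
  by move=> g h g1; rewrite /row_shift /= mulgA; exact: wc.
Qed.

End FreeCover.

(** The values of a finitary [psi] on the code can be prescribed by any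
    partition [p] of the Cantor space into pieces with the same labels: a
    minimal subset of the free cover of [Y] is perfect, and [perfect_homeo]
    identifies it with the Cantor space compatibly with [p] and [psi]. *)
Lemma realize (B S : finType) (Y : set (G -> B)) (psi : (G -> B) -> S)
    (p : (nat -> bool) -> S) :
  minimal_system e Y -> finitary e psi -> finitary id p ->
  (forall x, exists2 y, Y y & p x = psi y) ->
  (forall y, Y y -> exists x, p x = psi y) ->
  exists (zeta : Xi_min G) (b : (nat -> bool) -> B),
    [/\ finitary id b, symbolic_factor b zeta = Y &
        forall x, p x = psi (code b zeta x)].
Proof.
move=> Ys psif pf pY Yp.
pose row (w : G * G -> B * 'I_3) : G -> B := fun h => (w (1, h)).1.
have [M [MX Ms Md]] := exists_minimal_set (@row_shift1 B) (@row_shiftM B)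
  (@row_shift_unif B) (free_cover_system Ys).
have [M0 Mc Mi] := Ms.
have rowY w : M w -> Y (row w) by move=> /MX[].
have Mp : no_isolated e2 M.
  apply: (free_minimal_no_isolated (@row_shiftM B)
    (@row_shift_unif B) (bij_inj e_bij) Ms Md _ e2_surj) => g w /MX.
  exact: row_shift_free.
have pM : same_image [set: nat -> bool] M p (psi \o row).
  split=> [x _|w Mw]; last by have [x px] := Yp _ (rowY _ Mw); exists x.
  have [y Yy pxy] := pY x; have [n psin] := psif; have [w Mw] := M0.
  have [g yg] := Ys.2 _ _ n (rowY _ Mw) Yy.
  by exists (row_shift g w); [exact: Mi|rewrite pxy (psin _ _ yg)].
have [f [th [fM thM fc thc pf']]] := perfect_homeo nat_surj e2_surj
  (fun _ _ => Logic.I) Mc (ex_intro _ (fun=> false) Logic.I) M0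
  cantor_no_isolated Mp pf (finitary_unif (@row_unif B) psif) pM.
have {}fM x : M (f x) /\ th (f x) = x by exact: fM.
pose a g x := th (row_shift g (f x)).
have [|||x y n _ _|zeta zetaE] := @exists_minimal_action G a.
- by move=> x; rewrite /a row_shift1; case: (fM x).
- move=> g h x; rewrite /a row_shiftM.
  have [Mfx _] := fM x.
  by have [_ ->] := thM _ (Mi h _ Mfx).
- move=> g n; have [m thm] := thc n; have [l gl] := row_shift_unif B g m.
  have [k fk] := fc l; exists k => x y xy.
  have [Mx _] := fM x; have [My _] := fM y.
  by apply: thm; [exact: Mi|exact: Mi|exact/gl/(fk _ _ Logic.I Logic.I xy)].
- have [m thm] := thc n; have [Mx _] := fM x; have [My thy] := fM y.
  have [g xg] := Md _ _ m Mx My; exists g; rewrite /a -{1}thy.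
  by apply: thm => //; exact: Mi.
pose b x := row (f x) 1.
have bE x : code b zeta x = row (f x).
  apply/funext => h; rewrite /code /b zetaE /a.
  have [Mx _] := fM x; have [_ ->] := thM _ (Mi h^-1 _ Mx).
  by rewrite /row /row_shift /= invgK mulg1.
have bf : finitary id b.
  have [n rn] := finitary_coord B e_surj 1.
  have [m rm] := @row_unif B n; have [k fk] := fc m.
  by exists k => x y xy; exact/rn/rm/(fk _ _ Logic.I Logic.I xy).
exists zeta, b; split=> // [|x]; last by rewrite bE pf'.
apply: (orbit_dense_sub Ys.2); last first.
  by case: (symbolic_factor_system e_bij zeta bf).
by move=> _ [x _ <-]; rewrite bE; apply: rowY; case: (fM x).
Qed.

End Realization.

(** * Perturbing actions, and the Baire property *)

Section Closeness.
Variables (G : groupType) (e : nat -> G).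
Hypothesis e_bij : bijective e.
Implicit Types (xi eta zeta : Xi_min G) (x y : nat -> bool).

Let e_surj := bij_surj e_bij.

Lemma same_patterns_eq (A : finType) (X Y : set (G -> A)) :
  limit_closed e X -> limit_closed e Y ->
  (forall n, same_patterns e n X Y) -> X = Y.
Proof.
move=> Xc Yc XY; apply/seteqP; split=> z zX.
  by apply: Yc => n; have [/(_ _ zX)] := XY n.
apply: Xc => n; have [_ /(_ _ zX)[x Xx xz]] := XY n.
by exists x => //; exact: agree_sym.
Qed.

Lemma code_close (A : finType) (a : (nat -> bool) -> A) n : finitary id a ->
  exists m, forall xi eta, close e m xi eta ->
    forall x, agree e n (code a xi x) (code a eta x).
Proof.
move=> [l al].
have [|k i j ij ci xi eta /(close_le ij)/ci //|m cm] := @fin_bound 'I_n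
  (fun k m => forall xi eta, close e m xi eta ->
    forall x, code a xi x (e k) = code a eta x (e k)).
  move=> k; have [m cm] := close_act e_surj (e k)^-1 l.
  by exists m => xi eta /cm xe x; exact/al/xe.
by exists m => xi eta xe x k kn; exact: (cm (Ordinal kn) _ _ xe).
Qed.

Definition resolves (n : nat) (S : Type) (a : (nat -> bool) -> S) :=
  forall x y, a x = a y -> agree id n x y.

(** The code at [h] evaluates [a] along [h^-1], so the window has to contain the
    inverses of the first [n] group elements. *)
Lemma close_code n : exists m,
  forall (A : Type) (a : (nat -> bool) -> A) xi eta,
  resolves n a ->
  (forall x, agree e m (code a xi x) (code a eta x)) -> close e n xi eta.
Proof.
have [||m mP] := @fin_bound 'I_n (fun k m => exists2 i, i < m & e i = (e k)^-1).
- by move=> k; have [i <-] := e_surj (e k)^-1; exists i.+1, i.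
- by move=> k i j ij [l li el]; exists l => //; exact: leq_trans li ij.
exists m => A a xi eta asep xe k kn x; apply: asep.
have [i im ei] := mP (Ordinal kn).
by have := xe x _ im; rewrite /code ei invgK.
Qed.

Lemma symbolic_factor_close (A : finType) (a : (nat -> bool) -> A) n :
  finitary id a -> exists m, forall xi eta, close e m xi eta ->
    same_patterns e n (symbolic_factor a xi) (symbolic_factor a eta).
Proof.
move=> /(@code_close _ _ n)[m cm]; exists m => xi eta /cm xe.
split=> _ [x _ <-].
  by exists (code a eta x) => //; exists x.
by exists (code a xi x) => //; exists x.
Qed.

(** The window must contain [1]: there the code of a point is its label, which
    forces the new coding map to be [a] itself. *)
Lemma realize_close (A : finType) (a : (nat -> bool) -> A) (Y : set (G -> A))
    xi n :
  (exists2 i, i < n & e i = 1) -> finitary id a -> minimal_system e Y ->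
  same_patterns e n (symbolic_factor a xi) Y ->
  exists2 eta, symbolic_factor a eta = Y &
    forall x, agree e n (code a xi x) (code a eta x).
Proof.
move=> [i i_n ei] af Ys [aY Ya].
have [||eta [b [bf bY bE]]] := realize e_bij Ys (finitary_prefix e A n)
    (finitary_unif (code_unif e xi af) (finitary_prefix e A n)).
- move=> x; have [|y Yy xy] := aY (code a xi x); first by exists x.
  by exists y => //; exact/prefixP.
- by move=> y /Ya[_ [x _ <-] xy]; exists x; exact/prefixP.
have xe x : agree e n (code a xi x) (code b eta x) by exact/prefixP/bE.
suff ab : a = b by subst b; exists eta.
by apply/funext => x; have := xe x _ i_n; rewrite ei !code1.
Qed.

Lemma symbolic_factor_comp (A B : Type) (r : A -> B) (a : (nat -> bool) -> A)
    xi :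
  symbolic_factor (r \o a) xi = [set r \o y | y in symbolic_factor a xi].
Proof.
apply/seteqP; split=> [_ [x _ <-]|_ [_ [x _ <-] <-]]; last by exists x.
by exists (code a xi x) => //; exists x.
Qed.

(** By compactness, the time for orbits to reach the cylinders of level [k] is
    bounded; this makes minimality a countable intersection of open
    conditions. *)
Lemma uniformly_minimal xi k : exists N, forall x y,
  exists2 i, i < N & agree id k y (act xi (e i) x).
Proof.
have [t|t i j ij hi y yt x|N NP] := @fin_bound (k.-tuple bool) (fun t N =>
    forall y, prefix id k y = t -> forall x,
      exists2 i, i < N & agree id k y (act xi (e i) x)).
- have [[y0 y0t]|nt] := pselect (exists y, prefix id k y = t); last first.
    by exists 0 => y yt; case: nt; exists y.
  apply/not_existsP => nN; have /choice[u uP] N : exists x, forall i, i < N ->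
      ~ agree id k y0 (act xi (e i) x).
    apply: contrapT => nx; apply: (nN N) => y yt x; apply: contrapT => ni.
    apply: nx; exists x => i iN y0x; apply: ni; exists i => //.
    by apply: agree_trans y0x; apply/prefixP; rewrite yt.
  have [x xu] := word_cluster id u.
  have [g y0g] := @act_minimal G xi x y0 k Logic.I Logic.I.
  have [i ei] := e_surj g; have [m gm] := act_unif xi g k.
  have [j ij xj] := xu m i.+1; apply: (uP j i ij); rewrite ei.
  by apply: agree_trans y0g _; exact: gm.
- have [l li yl] := hi y yt x; exists l => //; exact: leq_trans li ij.
by exists N => x y; exact: NP.
Qed.

(** The Baire property of the space of minimal actions.  Nested closeness
    neighbourhoods converge to an action; at stage [k] the level is raised
    enough for the limit to inherit [P k] and the bounds of [uniformly_minimal]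
    at level [k], so that the limit is minimal. *)
Lemma minimal_baire (P : nat -> set (Xi_min G)) :
  (forall k xi n, exists2 eta, close e n xi eta &
     exists m, close e m eta `<=` P k) ->
  forall xi n, exists2 eta, close e n xi eta & forall k, P k eta.
Proof.
move=> Pd xi0 n0; have [idx eK idxK] := e_bij.
have /choice[next nextP] (s : nat * (Xi_min G * nat)) :
    exists t : Xi_min G * nat,
    [/\ close e s.2.2 s.2.1 t.1, s.2.2 <= t.2, s.1 < t.2,
        close e t.2 t.1 `<=` P s.1 & forall x y, exists2 i, i < t.2 &
          agree id s.1 y (act t.1 (e i) x)].
  case: s => k [xi n] /=; have [eta xe [m mP]] := Pd k xi n.
  have [N NP] := uniformly_minimal eta k.
  exists (eta, maxn (maxn n k.+1) (maxn m N)) => /=; split=> //.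
  - by rewrite !leq_max leqnn.
  - by rewrite !leq_max leqnn !orbT.
  - by move=> z ez; apply: mP; apply: close_le ez; rewrite !leq_max leqnn !orbT.
  - move=> x y; have [i iN xi'] := NP x y; exists i => //.
    by rewrite !leq_max iN !orbT.
pose s := nat_rect (fun=> (Xi_min G * nat)%type) (xi0, n0)
  (fun k t => next (k, t)).
pose X k := (s k).1; pose L k := (s k).2.
have sP k : [/\ close e (L k) (X k) (X k.+1), L k <= L k.+1, k < L k.+1,
    close e (L k.+1) (X k.+1) `<=` P k & forall x y, exists2 i, i < L k.+1 &
      agree id k y (act (X k.+1) (e i) x)] by exact: (nextP (k, s k)).
have Xclose i j : i <= j -> close e (L i) (X i) (X j) /\ L i <= L j.
  elim: j => [|j IH]; first by rewrite leqn0 => /eqP ->.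
  rewrite leq_eqVlt => /predU1P[->//|/IH[ij Lij]].
  have [Xj Lj _ _ _] := sP j; split; last exact: leq_trans Lj.
  exact: close_trans ij (close_le Lij Xj).
have Lge k : k <= L k by case: k => // k; case: (sP k).
(* The coordinate [i] of the image by [e j] is settled from stage
   [maxn j i] on, as levels are at least stages. *)
pose a g x i := act (X (maxn (idx g) i).+1) g x i.
have aE k j x : j < L k -> agree id (L k) (act (X k) (e j) x) (a (e j) x).
  move=> jk i ik; rewrite /a eK; set K := (maxn j i).+1.
  have jK : j < L K by apply: leq_trans (Lge K); rewrite ltnS leq_maxl.
  have iK : i < L K by apply: leq_trans (Lge K); rewrite ltnS leq_maxr.
  have [/Xclose[kK _]|/ltnW/Xclose[Kk _]] := leqP k K.
    exact: (kK j jk x i ik).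
  exact/esym/(Kk j jK x i iK).
have aclose g n : exists k0, forall k, k0 <= k -> forall x,
    agree id n (act (X k) g x) (a g x).
  exists (maxn (idx g).+1 n) => k; rewrite geq_max => /andP[gk nk] x.
  rewrite -(idxK g); apply: agree_le (aE k _ x _).
    exact: leq_trans (Lge k).
  by apply: leq_trans (Lge k).
have aunif g : unif_map id id (a g).
  move=> n; have [k kP] := aclose g n; have [m gm] := act_unif (X k) g n.
  exists m => x y /gm xy; apply: agree_trans (kP _ (leqnn k) y).
  by apply: agree_trans xy; apply: agree_sym; exact: kP.
have [|||x y n _ _|eta etaE] := @exists_minimal_action G a.
- move=> x; apply: (agree_ext nat_surj) => n; have [k kP] := aclose 1 n.
  by apply: agree_sym; rewrite -{1}(act1 (X k) x); exact: kP.
- move=> g h x; apply: (agree_ext nat_surj) => n.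
  have [k1 k1P] := aclose g n; have [m am] := aunif g n.
  have [k2 k2P] := aclose (g * h) n; have [k3 k3P] := aclose h m.
  pose k := maxn k1 (maxn k2 k3).
  have gk : agree id n (act (X k) g (act (X k) h x)) (a g (act (X k) h x)).
    by apply: k1P; rewrite leq_max leqnn.
  have hk : agree id m (act (X k) h x) (a h x).
    by apply: k3P; rewrite !leq_max leqnn !orbT.
  have ghk : agree id n (act (X k) (g * h) x) (a (g * h) x).
    by apply: k2P; rewrite !leq_max leqnn !orbT.
  apply: agree_trans (agree_sym ghk) _; rewrite actM.
  exact: agree_trans gk (am _ _ hk).
- exact: aunif.
- have [_ _ nL _ /(_ x y)[i iL yi]] := sP n; exists (e i).
  by apply: agree_trans yi _; apply: agree_le (aE _ _ x iL); exact: ltnW.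
have Xeta k : close e (L k) (X k) eta.
  by move=> j jk x; rewrite etaE; exact: aE.
by exists eta => [|k]; [exact: (Xeta 0)|case: (sP k) => _ _ _ + _; apply].
Qed.

End Closeness.

(** * From a comeager class to stability *)

Section Stability.
Variables (G : groupType) (e : nat -> G).
Hypothesis e_bij : bijective e.
Implicit Types (xi eta zeta : Xi_min G) (x y : nat -> bool).

Let e_surj := bij_surj e_bij.

Lemma nowhere_denseP (F : set (Xi_min G)) : nowhere_dense F <->
  forall xi n, exists2 eta, close e n xi eta &
    exists m, close e m eta `<=` ~` F.
Proof.
split=> [F0 xi n|Fd].
  apply: contrapT => nex.
  suff : (closure F)° xi by rewrite F0.
  suff nF : close e n xi `<=` closure F.
    exact: (filterS nF (close_nbhs e n xi)).
  move=> eta xe U /(nbhs_close e_surj)[m mU].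
  have : ~ close e m eta `<=` ~` F.
    by move=> mF; apply: nex; exists eta => //; exists m.
  move=> /existsNP[z /not_implyP[ez /contrapT Fz]].
  by exists z; split=> //; exact: mU.
apply/seteqP; split=> // xi /(nbhs_close e_surj)[n nF].
have [eta xe [m mF]] := Fd xi n.
have [z [Fz ez]] := nF _ xe _ (close_nbhs e m eta).
exact: mF ez Fz.
Qed.

Lemma conjugacy_class_minP xi0 zeta : conjugacy_class_min xi0 zeta <->
  exists f f', [/\ cancel f f', cancel f' f, unif_map id id f,
    unif_map id id f' & forall g x, act zeta g (f x) = f (act xi0 g x)].
Proof.
split=> [[h _ hE]|[f [f' [fK f'K fu f'u fE]]]].
  have hi := is_homeo_inv h.
  exists (homeo_fun h), (homeo_inv_fun h); split.
  - exact: (homeo_funK h).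
  - exact: (homeo_inv_funK h).
  - by apply/cantor_continuousP; have [k []] := homeo_funP h.
  - by apply/cantor_continuousP; have [k []] := hi.
  - by move=> g x; rewrite -[in RHS](homeo_funK h x) /act -hE.
have fh : is_homeo (f : cantor_space -> cantor_space).
  by exists f'; split=> //; exact/cantor_continuousP.
exists (mk_homeo fh) => //; apply/val_inj/funext => g; apply: homeo_eqP => x.
rewrite /= -[in RHS](homeo_inv_funK (mk_homeo fh) x).
exact/esym/fE.
Qed.

Definition locally_constant (A : Type) (a : (nat -> bool) -> A) xi :=
  exists m, forall zeta, close e m xi zeta ->
    symbolic_factor a zeta = symbolic_factor a xi.

Definition densely_stable := forall (A : finType) (a : (nat -> bool) -> A) xi n,
  finitary id a -> exists2 eta, close e n xi eta & locally_constant a eta.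

Lemma separated_patterns (A : finType) (X Y : set (G -> A)) :
  limit_closed e X -> limit_closed e Y -> X <> Y ->
  exists n, ~ same_patterns e n X Y.
Proof.
move=> Xc Yc XY; apply/existsNP => sXY; apply: XY.
exact: same_patterns_eq sXY.
Qed.

Lemma locally_constant_factor (A B : Type) (r : A -> B)
    (a : (nat -> bool) -> A) (b : (nat -> bool) -> B) xi :
  (forall x, b x = r (a x)) -> locally_constant a xi -> locally_constant b xi.
Proof.
move=> br [m am]; have -> : b = r \o a by apply/funext.
by exists m => zeta /am; rewrite !symbolic_factor_comp => ->.
Qed.

(** Clopen partitions are countably many; [a] fills the gaps of the
    enumeration. *)
Definition finitary_enum (A : finType) (a : (nat -> bool) -> A) (k : nat) :
    (nat -> bool) -> A :=
  if @unpickle {m : nat & {ffun m.-tuple bool -> A}} k is Some (existT m r)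
  then fun x => r (prefix id m x) else a.

Lemma finitary_enumP (A : finType) (a b : (nat -> bool) -> A) :
  finitary id b -> exists k, finitary_enum a k = b.
Proof.
move=> [m /finitary_prefix_factor/(_ (fun=> false))[r rE]].
exists (pickle (existT (fun m => {ffun m.-tuple bool -> A}) m (finfun r))).
by rewrite /finitary_enum pickleK; apply/funext => x; rewrite ffunE rE.
Qed.

Lemma finitary_enum_finitary (A : finType) (a : (nat -> bool) -> A) k :
  finitary id a -> finitary id (finitary_enum a k).
Proof.
move=> af; rewrite /finitary_enum; case: unpickle => // -[m r].
by exists m => x y /prefixP ->.
Qed.

(** If the factor coded by [a] were locally constant nowhere near [xi1], it
    could avoid there all the countably many factors of [xi0], and by the Baire
    property this would happen inside the class of [xi0]. *)
Lemma comeager_class_stable xi0 : comeager (conjugacy_class_min xi0) ->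
  densely_stable.
Proof.
move=> [F [F0 xiF]] A a xi1 n1 af; apply: contrapT => nst.
pose X k := symbolic_factor (finitary_enum a k) xi0.
pose Q k := [set z | close e n1 xi1 z -> symbolic_factor a z <> X k].
(* Even indices make the action leave the meager complement of the class, odd
   indices make its factor avoid the factors of [xi0]. *)
pose P k := if odd k then Q k./2 else ~` F k./2.
have clos b z : finitary id b -> limit_closed e (@symbolic_factor G A b z).
  by move=> bf; have [[]] := symbolic_factor_system e_bij z bf.
have Xc k : limit_closed e (X k).
  exact: clos (finitary_enum_finitary _ af).
have open_ne k eta : symbolic_factor a eta <> X k ->
    exists m, close e m eta `<=` [set z | symbolic_factor a z <> X k].
  move=> /(separated_patterns (clos _ _ af) (Xc k))[l nl].
  have [m mP] := symbolic_factor_close e_bij l af; exists m => z /mP ez zX.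
  by apply: nl; rewrite -zX.
have Pd k xi n : exists2 eta, close e n xi eta &
    exists m, close e m eta `<=` P k.
  rewrite /P; case: ifP => _; last first.
    exact: (iffLR (nowhere_denseP _) (F0 k./2)).
  have [xi1xi|nxi1] := pselect (close e n1 xi1 xi); last first.
    exists xi => //; exists n1 => z xz xi1z; case: nxi1.
    exact: close_trans xi1z (close_sym xz).
  suff [eta xe /open_ne[m me]] : exists2 eta, close e n xi eta &
      symbolic_factor a eta <> X k./2.
    by exists eta => //; exists m => z ez _; exact: me.
  have [xX|] := pselect (symbolic_factor a xi = X k./2); last by exists xi.
  apply: contrapT => nex; apply: nst; exists xi => //; exists n => z xz.
  by rewrite xX; apply: contrapT => zX; apply: nex; exists z.
have [z xi1z zP] := minimal_baire e_bij Pd xi1 n1.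
have /conjugacy_class_minP[f [f' [fK f'K fu f'u fE]]] :
    conjugacy_class_min xi0 z.
  apply: contrapT => /xiF[k _ Fz].
  by have := zP k.*2; rewrite /P odd_double doubleK; apply.
have [k kE] := finitary_enumP a (finitary_unif fu af).
have := zP k.*2.+1; rewrite /P /= odd_double /= uphalf_double => /(_ xi1z).
apply; rewrite /X kE; apply/seteqP; split=> [_ [x _ <-]|_ [x _ <-]].
  exists (f' x) => //; apply/funext => h.
  by rewrite /code /= -fE f'K.
by exists (f x) => //; apply/funext => h; rewrite /code /= -fE.
Qed.

End Stability.

(** * Stability and projective isolation *)

Section ProjectiveIsolation.
Variables (G : groupType) (e : nat -> G).
Hypothesis e_bij : bijective e.
Implicit Types (xi eta zeta : Xi_min G).

Let e_surj := bij_surj e_bij.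
Let e_one := one_below e_bij.

Lemma point_minimal_system : minimal_system e [set: G -> unit].
Proof.
split; first by split=> //; exists (fun=> tt).
by move=> x y n _ _; exists 1 => k _; case: (y (e k)); case: (shift_word _ _ _).
Qed.

Lemma realize_system (A : finType) (X : set (G -> A)) : minimal_system e X ->
  exists (zeta : Xi_min G) (b : (nat -> bool) -> A),
    finitary id b /\ symbolic_factor b zeta = X.
Proof.
move=> Xs; have [x0 Xx0] : X !=set0 by case: Xs => -[].
have [||||zeta [b [bf bX _]]] := @realize _ _ e_bij A unit X (fun=> tt)
    (fun=> tt) Xs.
- by exists 0.
- by exists 0.
- by move=> x; exists x0.
- by move=> y _; exists (fun=> false).
by exists zeta, b.
Qed.

Lemma letter_factor_map (A B : finType) (r : B -> A) (s : A -> B) :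
  cancel s r ->
  factor_map (fun y : full_shift G B => r \o y : full_shift G A).
Proof.
move=> sK; split=> [y U|g y|x]; first 1 last.
- by [].
- by exists (s \o x); apply/funext => h /=; rewrite sK.
move=> /(shift_nbhsP e_surj)[n nU]; apply/(shift_nbhsP e_surj).
by exists n => z yz; apply: nU => k kn; rewrite /= yz.
Qed.

(** The alphabet of the witness is a product with [A], so that the projection
    is onto whichever letters of [A] the subshift uses. *)
Lemma stable_projectively_isolated : densely_stable e ->
  forall A : finType, 0 < #|A| ->
    dense [set X : minimal_subshifts G A | projectively_isolated X].
Proof.
move=> st A A0 O [X OX] oO.
have Xs := minimal_subshift_system e_surj X.
have [n nO] := nbhs_same_patterns e_surj (open_nbhs_nbhs (conj oO OX)).
have [zeta [b [bf bX]]] := realize_system Xs.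
have [m mP] := symbolic_factor_close e_bij n bf.
have [eta /mP bze [m' bst]] := st A b zeta m bf.
have [X' X'E] := minimal_system_subshift e_surj
  (symbolic_factor_system e_bij eta bf).
exists X'; split; first by apply: nO; rewrite X'E -bX.
pose B : finType := (A * m'.-tuple bool)%type.
pose c x : B := (b x, prefix id m' x).
have cf : finitary id c by apply: finitary_pair => //; exact: finitary_prefix.
have [l lP] := close_code e_bij m'; have [l' ll' l'1] := e_one l.
have [Z ZE] := minimal_system_subshift e_surj
  (symbolic_factor_system e_bij eta cf).
pose U := [set Y | same_patterns e l' (minimal_subshift_set Z)
                                       (minimal_subshift_set Y)].
exists B, (fun w : full_shift G B => fst \o w : full_shift G A), U°; split.
- by apply/card_gt0P; exists (c (fun=> false)).
- exact: (@letter_factor_map A B fst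
    (fun a => (a, prefix id m' (fun=> false)))).
- exact: open_interior.
- by exists Z; exact: same_patterns_nbhs.
move=> Y /interior_subset; rewrite /U /= ZE => ZY.
have [z zY ez] := realize_close e_bij l'1 cf
  (minimal_subshift_system e_surj Y) ZY.
have /bst : close e m' eta z.
  apply: (lP _ c) => [x y /(congr1 snd)/prefixP//|x].
  exact: agree_le (ez x).
rewrite X'E => <-; rewrite -[minimal_subshift_set Y]zY.
exact/esym/symbolic_factor_comp.
Qed.

(** An equivariant map between full shifts is determined by its letter at
    [1]. *)
Lemma code_block (A B : finType) (Phi : full_shift G B -> full_shift G A)
    (b : (nat -> bool) -> B) (c : (nat -> bool) -> A) zeta :
  (forall g x, Phi (shift g x) = shift g (Phi x)) ->
  (forall x, Phi (code b zeta x) 1 = c x) ->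
  forall x, code c zeta x = Phi (code b zeta x).
Proof.
move=> Phieq Phi1 x; apply/funext => h; rewrite /code -Phi1 code_act.
by rewrite (Phieq h^-1 (code b zeta x)) /shift invgK mulg1.
Qed.

(** The action is moved first so that the patterns of the factor coded by [c]
    become those of an isolated [Y], then so that this factor is the image of a
    member [Y0] of [U].  Close actions code by [b] into [U], and [Phi] carries
    the code by [b] to the code by [c] because it reads finitely many
    letters. *)
Lemma projectively_isolated_stable :
  (forall A : finType, 0 < #|A| ->
    dense [set X : minimal_subshifts G A | projectively_isolated X]) ->
  densely_stable e.
Proof.
move=> iso A a xi n [k0 ak0]; pose N := maxn k0 n.
pose c : (nat -> bool) -> _ := fun x => prefix id N x.
have cf : finitary id c by exact: finitary_prefix.
have [r rE] : exists r, forall x, a x = r (c x).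
  apply: finitary_prefix_factor (fun=> false) => x y xy; apply: ak0.
  exact: agree_le (leq_maxl _ _) xy.
have [m mP] := close_code e_bij n; have [l ml l1] := e_one m.
have [X XE] := minimal_system_subshift e_surj
  (symbolic_factor_system e_bij xi cf).
have [||Y [Yl [B [Phi [U [B0 [Phic Phieq _] oU [Y0 UY0] UY]]]]]] :=
  iso (N.-tuple bool) _ [set Y | same_patterns e l (minimal_subshift_set X)
                                   (minimal_subshift_set Y)]° _
           (open_interior _).
- by apply/card_gt0P; exists (c (fun=> false)).
- by exists X; exact: same_patterns_nbhs.
move: Yl => /interior_subset /= [XY YX].
have Phiu : unif_map e e Phi.
  apply: unif_map_coord => h; apply: locally_finitary => x.
  have /Phic/(shift_nbhsP e_surj)[j jP] : nbhs (Phi x)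
      [set y : full_shift G _ | Phi x h = y h].
    have [j jP] := finitary_coord (N.-tuple bool) e_surj h.
    by apply/(shift_nbhsP e_surj); exists j => y /jP.
  by exists j.
have [||zeta [b [bf bY bE]]] := realize e_bij
    (minimal_subshift_system e_surj Y0)
    (finitary_unif Phiu (finitary_prefix e _ l))
    (finitary_unif (code_unif e xi cf) (finitary_prefix e _ l)).
- move=> x; have [|z Yz xz] := XY (code c xi x); first by rewrite XE; exists x.
  move: Yz; rewrite -(UY _ UY0) => -[y Y0y yz]; exists y => //=.
  by apply/prefixP; rewrite yz.
- move=> y Y0y; have [|z Xz zy] := YX (Phi y).
    by rewrite -(UY _ UY0); exists y.
  by move: Xz; rewrite XE => -[x _ xz]; exists x; apply/prefixP; rewrite xz.
have {}bE x : agree e l (code c xi x) (Phi (code b zeta x)) by exact/prefixP/bE.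
have Phi1 x : Phi (code b zeta x) 1 = c x.
  by have [i il ei] := l1; have := bE x i il; rewrite ei code1.
have cE := code_block Phieq Phi1.
exists zeta.
  apply: (mP _ c) => [x y /prefixP|x].
    by apply: agree_le; exact: leq_maxr.
  by rewrite cE; exact: agree_le (bE x).
apply: (locally_constant_factor rE).
have [n1 n1U] := nbhs_same_patterns e_surj (open_nbhs_nbhs (conj oU UY0)).
have [m1 m1P] := symbolic_factor_close e_bij n1 bf.
have [n2 n2P] := Phiu l.
have [m2 m2P] := code_close e_bij n2 bf.
have image z : (forall x, Phi (code b z x) 1 = c x) ->
    symbolic_factor c z = Phi @` symbolic_factor b z.
  move=> /(code_block Phieq) zE; apply/seteqP.
  split=> [_ [x _ <-]|_ [_ [x _ <-] <-]]; last by exists x; rewrite ?zE.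
  by exists (code b z x); [exists x|rewrite zE].
exists (maxn m1 m2) => z ez; rewrite !image// => [|x]; last first.
  have /m2P/(_ x)/n2P xz := close_le (leq_maxr m1 m2) ez.
  by have [i il ei] := l1; have := xz i il; rewrite ei Phi1 => <-.
have [Z ZE] := minimal_system_subshift e_surj
  (symbolic_factor_system e_bij z bf).
rewrite -ZE UY; first by rewrite bY UY.
by apply: n1U; rewrite ZE -bY; apply: m1P; exact: close_le (leq_maxl m1 m2) ez.
Qed.

End ProjectiveIsolation.

(** * Generic actions *)

Section GenericActions.
Variables (G : groupType) (e : nat -> G).
Hypothesis e_bij : bijective e.
Implicit Types (xi eta zeta : Xi_min G).

Let e_surj := bij_surj e_bij.
Let e_one := one_below e_bij.

(** Two extensions of the same minimal subshift have a common minimal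
    extension inside their fibered product; realizing it near [eta] extends the
    coding [b] of [eta] to a coding of [X2]. *)
Lemma amalgamate (A A2 : finType) (b : (nat -> bool) -> A) (s : A2 -> A)
    (X2 : set (G -> A2)) eta j :
  finitary id b -> minimal_system e X2 ->
  [set s \o y | y in X2] = symbolic_factor b eta ->
  exists2 eta' : Xi_min G, close e j eta eta' &
    exists b2 : (nat -> bool) -> A2,
      [/\ finitary id b2, s \o b2 = b & symbolic_factor b2 eta' = X2].
Proof.
move=> [k0 bk0] X2s sX2; pose N := maxn k0 j.
pose c : (nat -> bool) -> _ := fun x => prefix id N x.
have cf : finitary id c by exact: finitary_prefix.
have [r rE] : exists r, forall x, b x = r (c x).
  apply: finitary_prefix_factor (fun=> false) => x y xy; apply: bk0.
  exact: agree_le (leq_maxl _ _) xy.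
have Zs := symbolic_factor_system e_bij eta cf.
set Z := symbolic_factor c eta in Zs.
have [[[x0 Xx0] Xc Xi] Xd] := X2s; have [[_ Zc Zi] Zd] := Zs.
pose C : finType := (A2 * N.-tuple bool)%type.
pose W : set (G -> C) := [set w | [/\ X2 (fst \o w), Z (snd \o w) &
  forall h, s (w h).1 = r (w h).2]].
have coordC h : finitary e (fun w : G -> C => w h) by exact: finitary_coord.
have fstu : unif_map e e (fun w : G -> C => fst \o w).
  by apply: unif_map_coord => h; apply: (finitary_comp fst).
have sndu : unif_map e e (fun w : G -> C => snd \o w).
  by apply: unif_map_coord => h; apply: (finitary_comp snd).
have Ws : closed_system e (@shift_word G C) W.
  split.
  - have [x _ xE] : symbolic_factor b eta (s \o x0) by rewrite -sX2; exists x0.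
    exists (fun h => (x0 h, code c eta x h)); split=> //=; first by exists x.
    by move=> h; have := congr1 (@^~ h) xE; rewrite /code /= rE => <-.
  - move=> w wc; split.
    + apply: Xc => n; have [m mP] := fstu n; have [v [Xv _ _] wv] := wc m.
      by exists (fst \o v) => //; exact: mP.
    + apply: Zc => n; have [m mP] := sndu n; have [v [_ Zv _] wv] := wc m.
      by exists (snd \o v) => //; exact: mP.
    + move=> h; have [m mP] := coordC h; have [v [_ _ vE] wv] := wc m.
      by rewrite (mP _ _ wv).
  - move=> g w [Xw Zw wE]; split; [exact: Xi Xw|exact: Zi Zw|].
    by move=> h; exact: wE.
have [M [MW Ms Md]] := exists_minimal_set (@shift_word1 G C)
  (@shift_wordM G C) (@shift_word_unif G e C e_surj) Ws.
have [[w0 Mw0] Mc Mi] := Ms.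
have [m mP] := close_code e_bij j; have [l ml l1] := e_one m.
have [||eta' [d [df dM dE]]] := realize e_bij (conj Ms Md)
    (finitary_unif sndu (finitary_prefix e _ l))
    (finitary_unif (code_unif e eta cf) (finitary_prefix e _ l)).
- move=> x; have [_ Zw0 _] := MW _ Mw0.
  have [|g xg] := Zd _ (code c eta x) l Zw0; first by exists x.
  by exists (shift_word g w0); [exact: Mi|exact/prefixP].
- by move=> w /MW[_ [x _ xw] _]; exists x; rewrite /= xw.
have {}dE x : agree e l (code c eta x) (snd \o code d eta' x).
  exact/prefixP/dE.
have sndd x : (d x).2 = c x.
  by have [i il ei] := l1; have := dE x i il; rewrite /= ei !code1.
have dMx x : M (code d eta' x) by rewrite -dM; exists x.
exists eta'.
  apply: (mP _ c) => [x y /prefixP|x].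
    by apply: agree_le; exact: leq_maxr.
  have -> : code c eta' x = snd \o code d eta' x.
    by apply/funext => h; rewrite /code /= sndd.
  exact: agree_le (dE x).
have d2f : finitary id (fst \o d) by exact: finitary_comp.
exists (fst \o d); split=> //.
- apply/funext => x /=; rewrite rE -sndd.
  by have [_ _ /(_ 1)] := MW _ (dMx x); rewrite code1.
- apply: (orbit_dense_sub Xd); last first.
    by case: (symbolic_factor_system e_bij eta' d2f).
  by move=> _ [x _ <-]; have [] := MW _ (dMx x).
Qed.

(** Alphabets are restricted to the binary words of a fixed length, and [X] is
    matched on a finite window only, so that there are countably many
    conditions. *)
Definition extends_to (k l n : nat) (b : (nat -> bool) -> k.-tuple bool)
    (s : l.-tuple bool -> k.-tuple bool) (X : set (G -> l.-tuple bool)) eta :=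
  exists b2, [/\ finitary id b2, s \o b2 = b &
    same_patterns e n X (symbolic_factor b2 eta)].

Definition extendable eta := forall (k l n : nat)
    (b : (nat -> bool) -> k.-tuple bool) (s : l.-tuple bool -> k.-tuple bool)
    (X : set (G -> l.-tuple bool)),
  finitary id b -> minimal_system e X ->
  [set s \o y | y in X] = symbolic_factor b eta ->
  extends_to n b s X eta.

Definition generic eta :=
  (forall n, locally_constant e (fun x : nat -> bool => prefix id n x) eta) /\
  extendable eta.

Definition patterns (A : finType) n (X : set (G -> A)) : {set n.-tuple A} :=
  [set t | `[< exists2 x, X x & prefix e n x = t >]]%SET.

Lemma patternsP (A : finType) n (X Y : set (G -> A)) :
  patterns n X = patterns n Y <-> same_patterns e n X Y.
Proof.
split=> [/setP XY|[XY YX]].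
  split=> z Xz; have := XY (prefix e n z); rewrite !inE.
    rewrite asboolT; last by exists z.
    by move=> /esym/asboolP[y Yy /prefixP yz]; exists y => //; exact: agree_sym.
  rewrite [RHS]asboolT; last by exists z.
  by move=> /asboolP[y Yy /prefixP yz]; exists y.
apply/setP => t; rewrite !inE; apply/asboolP/asboolP => -[z Xz <-].
  by have [y Yy zy] := XY _ Xz; exists y => //; apply/prefixP/agree_sym.
by have [y Yy zy] := YX _ Xz; exists y => //; apply/prefixP.
Qed.

(** A subshift enters a condition only through its finite set of patterns,
    which leaves countably many conditions. *)
Definition condition : countType := {t : (nat * nat) * (nat * nat) &
  ({ffun t.1.1.-tuple bool -> t.1.2.-tuple bool} *
   {ffun t.2.1.-tuple bool -> t.1.2.-tuple bool} *
   {set t.2.2.-tuple (t.2.1.-tuple bool)})%type}.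

Definition satisfies (c : condition) : set (Xi_min G) :=
  let: existT t (b, s, P) := c in
  [set eta | (exists X, [/\ minimal_system e X,
      [set s \o y | y in X] = symbolic_factor (b \o prefix id t.1.1) eta &
      patterns t.2.2 X = P]) ->
    exists b2, [/\ finitary id b2, s \o b2 = b \o prefix id t.1.1 &
      patterns t.2.2 (symbolic_factor b2 eta) = P]].

Lemma satisfies_extendable eta : (forall c, satisfies c eta) -> extendable eta.
Proof.
move=> sat k l n b s X.
move=> [m /finitary_prefix_factor/(_ (fun=> false))[r rE]] Xs sX.
have bE : b = finfun r \o prefix id m.
  by apply/funext => x; rewrite /= ffunE rE.
have sE : s = finfun s by apply/funext => x; rewrite ffunE.
have [] := sat (existT _ ((m, k), (l, n)) (finfun r, finfun s, patterns n X)).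
  by exists X; split=> //=; rewrite -bE -sE.
move=> b2 [b2f sb2 b2X]; exists b2; split=> //; first by rewrite sE bE.
exact/patternsP/esym.
Qed.

(** Once the factor coded by [a] is constant near [eta], so is the existence of
    [X]; if [X] exists, amalgamation provides the refinement. *)
Lemma satisfies_dense c xi n : densely_stable e ->
  exists2 eta, close e n xi eta & exists m, close e m eta `<=` satisfies c.
Proof.
move=> st; case: c => -[[m k] [l q]] [[b s] P] /=.
set a := b \o prefix id m.
have af : finitary id a by apply: finitary_comp; exact: finitary_prefix.
have [eta xe [m1 m1P]] := st _ a xi n af.
have [[X [Xs sX XP]]|nX] := pselect (exists X, [/\ minimal_system e X,
    [set s \o y | y in X] = symbolic_factor a eta & patterns q X = P]);
  last first.
  exists eta => //; exists m1 => z ez [X [Xs sX XP]].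
  by case: nX; exists X; rewrite -(m1P _ ez).
have [eta' ee' [b2 [b2f sb2 b2X]]] := amalgamate n af Xs sX.
exists eta'; first exact: close_trans xe ee'.
have [m2 m2P] := symbolic_factor_close e_bij q b2f.
exists m2 => z /m2P/patternsP ez _; exists b2; split=> //.
by rewrite -ez b2X.
Qed.

Lemma locally_constant_open (A : Type) (a : (nat -> bool) -> A) eta :
  locally_constant e a eta -> exists m,
    close e m eta `<=` [set z | locally_constant e a z].
Proof.
move=> [m mP]; exists m => z ez; exists m => z' zz'.
by rewrite (mP z' (close_trans ez zz')) (mP z ez).
Qed.

Lemma generic_dense_open : densely_stable e ->
  exists P : nat -> set (Xi_min G),
    (forall k xi n, exists2 eta, close e n xi eta &
      exists m, close e m eta `<=` P k) /\
    (forall eta, (forall k, P k eta) -> generic eta).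
Proof.
move=> st; pose P k : set (Xi_min G) := match unpickle k with
  | Some (inl n) => [set z | locally_constant e (fun x : nat -> bool =>
                                                   prefix id n x) z]
  | Some (inr c) => satisfies c
  | None => setT
  end.
exists P; split=> [k xi n|eta Peta].
  rewrite /P; case: unpickle => [[n'|c]|]; last by exists xi => //; exists 0.
    have [eta xe ec] := st _ _ xi n (finitary_prefix id bool n').
    by exists eta => //; exact: locally_constant_open.
  exact: satisfies_dense.
split=> [n|].
  by have := Peta (pickle (inl n : nat + condition)); rewrite /P pickleK.
apply: satisfies_extendable => c.
by have := Peta (pickle (inr c : nat + condition)); rewrite /P pickleK.
Qed.

End GenericActions.

(** * Generic actions are conjugate *)

Section Conjugacy.
Variables (G : groupType) (e : nat -> G).
Hypothesis e_bij : bijective e.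
Implicit Types (xi eta zeta : Xi_min G).

Let e_surj := bij_surj e_bij.
Let e_one := one_below e_bij.

(** One step of the back and forth.  The factor coded by [a'], the first [n']
    coordinates, is constant near [xi], hence determined by finitely many
    patterns of the factor coded by a finer [c].  Genericity of [eta] refines
    [b] to [b3] with the same patterns, and by [realize_close] the factor coded
    by [b3] is coded by [c] over an action close to [xi]. *)
Lemma generic_extend xi eta k (a b : (nat -> bool) -> k.-tuple bool) n :
  generic e xi -> generic e eta -> finitary id a -> finitary id b ->
  symbolic_factor a xi = symbolic_factor b eta ->
  exists k' (r : k'.-tuple bool -> k.-tuple bool) a' b',
    [/\ finitary id a', finitary id b', r \o a' = a /\ r \o b' = b,
      resolves n a' & symbolic_factor a' xi = symbolic_factor b' eta].
Proof.
move=> [xic _] [_ etae] [k0 ak0] bf ab.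
pose n' := maxn n k0; pose a' : (nat -> bool) -> _ := fun x => prefix id n' x.
have [m mP] := xic n'; pose N := maxn n' m.
pose c : (nat -> bool) -> _ := fun x => prefix id N x.
have a'f : finitary id a' by exact: finitary_prefix.
have cf : finitary id c by exact: finitary_prefix.
have [r rE] : exists r, forall x, a x = r (a' x).
  apply: finitary_prefix_factor (fun=> false) => x y xy; apply: ak0.
  exact: agree_le (leq_maxr _ _) xy.
have [t tE] : exists t, forall x, a' x = t (c x).
  apply: finitary_prefix_factor (fun=> false) => x y xy; apply/prefixP.
  exact: agree_le (leq_maxl _ _) xy.
have a'E : a' = t \o c by exact/funext.
have aE : a = (r \o t) \o c by apply/funext => x; rewrite /= -tE.
have [m' m'P] := close_code e_bij m; have [l ml l1] := e_one m'.
have [|b3 [b3f b3E b3X]] := etae _ _ l b (r \o t) _ bf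
    (symbolic_factor_system e_bij xi cf).
  by rewrite -ab aE [RHS]symbolic_factor_comp.
have [z zE xz] := realize_close e_bij l1 cf
  (symbolic_factor_system e_bij eta b3f) b3X.
exists n', r, a', (t \o b3); split=> //.
- exact: finitary_comp.
- by split; [apply/funext => x; rewrite /= -rE|].
- by move=> x y /prefixP; apply: agree_le; exact: leq_maxl.
rewrite [RHS]symbolic_factor_comp -zE -symbolic_factor_comp -a'E.
apply/esym/mP/(m'P _ c) => [x y /prefixP|x].
  by apply: agree_le; exact: leq_maxr.
exact: agree_le (xz x).
Qed.

(** Equality of the factors coded by [a] and [b] says more than a matching of
    labels: each [x] has a partner [y] with the same itinerary.  For fine
    partitions [y] is close to [f x] while the images of [y] are close to the
    images by [f], which makes [f] equivariant. *)
Lemma generic_conjugate xi eta : generic e xi -> generic e eta ->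
  conjugacy_class_min xi eta.
Proof.
move=> xig etag.
pose P S := exists k (a b : (nat -> bool) -> k.-tuple bool),
  [/\ finitary id a, finitary id b, symbolic_factor a xi = symbolic_factor b eta
    & S = (fun x y => a x = b y)].
pose z0 : (nat -> bool) -> 0.-tuple bool := fun=> [tuple].
have tc : limit_closed id [set: nat -> bool] by [].
have [||||f [g [fg gf fu gu [_ fP]]]] :=
    @back_and_forth nat nat id id bool bool setT setT P
      (fun x y => z0 x = z0 y) tc tc nat_surj nat_surj.
- by exists (fun=> false).
- move=> _ [k [a [b [af bf ab ->]]]]; apply: same_image_matching => //.
  split=> [x _|y _].
    have [y _ yx] : symbolic_factor b eta (code a xi x).
      by rewrite -ab; exists x.
    by exists y => //; have := congr1 (@^~ 1) yx; rewrite !code1.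
  have [x _ xy] : symbolic_factor a xi (code b eta y) by rewrite ab; exists y.
  by exists x => //; have := congr1 (@^~ 1) xy; rewrite !code1.
- move=> _ n [k [a [b [af bf ab ->]]]].
  have [k1 [r1 [a1 [b1 [a1f b1f [ra rb] a1s ab1]]]]] :=
    generic_extend n xig etag af bf ab.
  have [k2 [r2 [b2 [a2 [b2f a2f [rb2 ra2] b2s ab2]]]]] :=
    generic_extend n etag xig b1f a1f (esym ab1).
  exists (fun x y => a2 x = b2 y); split.
  + by exists k2, a2, b2; split.
  + by move=> x y _ _ xy; rewrite -ra -rb -ra2 -rb2 /= xy.
  split=> x y y' _ _ _; rewrite /flip_rel => xy xy'.
    by apply: b2s; rewrite -xy.
  by apply: a1s; rewrite -ra2 /= xy xy'.
- exists 0, z0, z0; split=> //; first by exists 0.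
    by exists 0.
have fK x : g (f x) = x by have [] := fg x Logic.I.
have gK y : f (g y) = y by have [] := gf y Logic.I.
apply/conjugacy_class_minP; exists f, g; split=> //.
- by move=> n; have [m mP] := fu n; exists m => x y; exact: mP.
- by move=> n; have [m mP] := gu n; exists m => x y; exact: mP.
move=> h x; apply: (agree_ext nat_surj) => n.
have [m hm] := act_unif eta h n.
have [_ [[k [a [b [af bf ab ->]]]] [Ss _] fS]] := fP (maxn m n).
have [y _ yx] : symbolic_factor b eta (code a xi x) by rewrite -ab; exists x.
have yE h' : a (act xi h'^-1 x) = b (act eta h'^-1 y).
  exact: esym (congr1 (@^~ h') yx).
have fxy : agree id m (f x) y.
  apply: (agree_le (leq_maxl m n)); apply: (Ss x) => //; first exact: fS.
  by have := yE 1; rewrite invg1 !act1.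
apply: agree_trans (hm _ _ fxy) _.
apply: (agree_le (leq_maxr m n)); apply: (Ss (act xi h x)) => //.
  by have := yE h^-1; rewrite invgK.
exact: fS.
Qed.

Lemma stable_comeager_class : densely_stable e ->
  exists xi : Xi_min G, comeager (conjugacy_class_min xi).
Proof.
move=> /(generic_dense_open e_bij)[P [Pd Pg]].
have [xi0 _] := realize_system e_bij (@point_minimal_system G e).
have [xi _ /Pg xig] := minimal_baire e_bij Pd xi0 0.
exists xi, (fun k => ~` P k); split=> [k|eta neta].
  apply/(nowhere_denseP e_bij) => eta n; have [z ez [m mP]] := Pd k eta n.
  by exists z => //; exists m => w /mP Pw; apply.
apply: contrapT => nP; apply: neta; apply: generic_conjugate => //.
by apply: Pg => k; apply: contrapT => nPk; apply: nP; exists k.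
Qed.

End Conjugacy.

Lemma infinite_enumeration (T : choiceType) : countable [set: T] ->
  infinite_set [set: T] -> exists e : nat -> T, bijective e.
Proof.
move=> cT /infiniteP iT.
have /card_bijP[f [h fh hf]] : ([set: nat] #= [set: T])%card.
  by rewrite card_eq_le iT; exact: cT.
exists (fun n => val (f (to_setT n))).
exists (fun t => val (h (to_setT t))) => x.
  by rewrite (_ : to_setT _ = f (to_setT x)) ?fh//; exact/val_inj.
by rewrite (_ : to_setT _ = h (to_setT x)) ?hf//; exact/val_inj.
Qed.

Theorem theorem1p1 (G : groupType)
    (G_countable : countable [set: G]%classic)
    (G_infinite : infinite_set [set: G]%classic) :
  (exists xi : Xi_min G, comeager (conjugacy_class_min xi))
  <->
  (forall A : finType, (0 < #|A|)%N ->
     dense [set X : minimal_subshifts G A | projectively_isolated X]%classic).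
Proof.
have [e e_bij] := infinite_enumeration G_countable G_infinite.
split=> [[xi /(comeager_class_stable e_bij) st] A A0|iso].
  exact: (stable_projectively_isolated e_bij).
exact/(stable_comeager_class e_bij)/(projectively_isolated_stable e_bij).
Qed.
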